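(* Let $X$ be a real Banach space, with dual $X^{\ast}$ endowed with the dual norm topology and bidual $X^{\ast\ast}=(X^{\ast},\|\cdot\|_{\ast})^{\ast}$. Let $f,g\in\Gamma_{0}(X)$ be such that $\operatorname{dom}f\cap\operatorname{dom}g\neq\emptyset$. Then the following statements are equivalent: $(v)$ $\overline{f+g}^{w^{\ast\ast}}=\overline{f}^{w^{\ast\ast}}+\overline{g}^{w^{\ast\ast}}$ (as functions on $X^{\ast\ast}$). $(vi)$ For all $x\in X$ and $x^{\ast}\in\partial(f+g)(x)$, there are sequences $(x_{n}),(y_{n})\subset X$ with $x_{n}\to x$, $y_{n}\to x$, and $x_{n}^{\ast}\in\partial f(x_{n})$, $y_{n}^{\ast}\in\partial g(y_{n})$ such that $$\langle x_{n}^{\ast},x_{n}-x\rangle\to 0,\quad \langle y_{n}^{\ast},y_{n}-x\rangle\to 0,\quad f(x_{n})\to f(x),\quad g(y_{n})\to g(x),$$ and $$\|x_{n}^{\ast}+y_{n}^{\ast}-x^{\ast}\|_{\ast}\to 0.$$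
   Context: $\Gamma_{0}(X)$ is the family of proper lower semicontinuous convex functions $X\to\mathbb{R}\cup\{+\infty\}$ (proper: never $-\infty$ and with nonempty domain $\operatorname{dom}f:=\{x\in X: f(x)<+\infty\}$). $\|\cdot\|_{\ast}$ is the dual norm on $X^{\ast}$. With $f^{\ast}(x^{\ast}):=\sup_{x\in X}\{\langle x^{\ast},x\rangle-f(x)\}$, the Fenchel subdifferential is $\partial f(x):=\{x^{\ast}\in X^{\ast}: f^{\ast}(x^{\ast})+f(x)\le\langle x^{\ast},x\rangle\}$, and $\partial f(x)=\emptyset$ if $f(x)\notin\mathbb{R}$. $X$ is viewed as a subspace of $X^{\ast\ast}$, and $w^{\ast\ast}:=\sigma(X^{\ast\ast},X^{\ast})$. For $f:X\to\mathbb{R}\cup\{+\infty\}$, $\overline{f}^{w^{\ast\ast}}:X^{\ast\ast}\to\mathbb{R}\cup\{\pm\infty\}$ is the $w^{\ast\ast}$-lower semicontinuous hull of the extension of $f$ by $+\infty$ to $X^{\ast\ast}\setminus X$, i.e. $\overline{f}^{w^{\ast\ast}}(x)=\sup_{U}\inf_{y\in (x+U)\cap X}f(y)$ for $x\in X^{\ast\ast}$, the supremum being over a basis of $w^{\ast\ast}$-neighborhoods $U$ of the origin in $X^{\ast\ast}$. *)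

(* Defs.v *)
From HB Require Import structures.
From mathcomp Require Import all_boot all_order all_algebra.
From mathcomp Require Import all_classical all_reals.
From mathcomp Require Import ereal topology normedtype sequences.

Set Implicit Arguments.
Unset Strict Implicit.
Unset Printing Implicit Defensive.

Import Order.TTheory GRing.Theory Num.Theory.
Import numFieldNormedType.Exports.

Local Open Scope classical_set_scope.
Local Open Scope ring_scope.

Section dual_space.
Context {R : realType} (X : normedModType R).

Definition continuous_linear_form : {pred X -> R^o} :=
  [pred f | `[< linear f /\ continuous f >]].

Record dual := Dual {
  dual_fun :> X -> R^o ;
  dual_funP : dual_fun \in continuous_linear_form }.

HB.instance Definition _ := [isSub for dual_fun].
HB.instance Definition _ := [Choice of dual by <:].

Lemma continuous_linear_form_submod_closed :
  submod_closed continuous_linear_form.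
Proof.
split.
- apply/asboolP; split; last exact: cst_continuous.
  by move=> a x y /=; rewrite scaler0 addr0.
- move=> a f g /asboolP[lf cf] /asboolP[lg cg]; apply/asboolP; split.
    move=> b x y; rewrite /GRing.add /GRing.scale/= lf lg.
    rewrite -!/(GRing.scale _ _) -!/(GRing.add _ _) !scalerDr !scalerA (mulrC a).
    by rewrite addrACA.
  move=> x; apply: (@cvgD _ R^o); last exact: cg.
  by apply: (@cvgZl_tmp _ R^o); exact: cf.
Qed.

HB.instance Definition _ := GRing.isSubmodClosed.Build _ _
  continuous_linear_form continuous_linear_form_submod_closed.
HB.instance Definition _ := [SubChoice_isSubLmodule of dual by <:].

Lemma dual_linear (phi : dual) : linear phi.
Proof. by have /asboolP[] := dual_funP phi. Qed.

HB.instance Definition _ (phi : dual) :=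
  GRing.isLinear.Build R X R^o *:%R phi (dual_linear phi).

Lemma dual_continuous (phi : dual) : continuous phi.
Proof. by have /asboolP[] := dual_funP phi. Qed.

Definition dual_norm (phi : dual) : R :=
  sup [set `|phi x| | x in [set x : X | `|x| <= 1]].

Lemma dual_norm_has_sup (phi : dual) :
  has_sup [set `|phi x| | x in [set x : X | `|x| <= 1]].
Proof.
split; first by exists `|phi 0|; exists 0 => //=; rewrite normr0.
have /bounded_funP/(_ 1)[M phiM] : bounded_near phi (nbhs (0 : X)).
  by apply/linear_bounded_continuous; exact: dual_continuous.
by exists M => _ [x /= x1 <-]; exact: phiM.
Qed.

Lemma dual_norm_ub (phi : dual) x : `|x| <= 1 -> `|phi x| <= dual_norm phi.
Proof. by move=> x1; apply: sup_upper_bound (dual_norm_has_sup phi) _ _; exists x. Qed.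

Lemma dual_norm_le (phi : dual) M :
  (forall x, `|x| <= 1 -> `|phi x| <= M) -> dual_norm phi <= M.
Proof.
move=> phiM; apply: ge_sup; first by have [] := dual_norm_has_sup phi.
by move=> _ [x /= x1 <-]; exact: phiM.
Qed.

Lemma dual_norm_ge0 (phi : dual) : 0 <= dual_norm phi.
Proof. by apply: le_trans (dual_norm_ub phi (_ : `|0| <= 1)); rewrite ?normr0. Qed.

Lemma dual_normP (phi : dual) x : `|phi x| <= dual_norm phi * `|x|.
Proof.
have [->|x0] := eqVneq x 0; first by rewrite linear0 !normr0 mulr0.
rewrite -ler_pdivrMr ?normr_gt0//.
have := @dual_norm_ub phi (`|x|^-1 *: x).
rewrite linearZ/= normrM normfV normr_id mulrC; apply.
by rewrite normfZV.
Qed.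

Lemma dual_normD phi psi : dual_norm (phi + psi) <= dual_norm phi + dual_norm psi.
Proof.
apply: dual_norm_le => x x1.
by rewrite (le_trans (ler_normD _ _))// lerD// dual_norm_ub.
Qed.

Lemma dual_normZ a phi : dual_norm (a *: phi) = `|a| * dual_norm phi.
Proof.
have le b psi : dual_norm (b *: psi) <= `|b| * dual_norm psi.
  by apply: dual_norm_le => x x1; rewrite normrM ler_wpM2l// dual_norm_ub.
apply/eqP; rewrite eq_le le/=.
have [->|a0] := eqVneq a 0; first by rewrite normr0 mul0r dual_norm_ge0.
rewrite -ler_pdivlMl ?normr_gt0// -normfV.
by rewrite -{1}[phi](scalerK a0) le.
Qed.

Lemma dual_norm0_eq0 phi : dual_norm phi = 0 -> phi = 0.
Proof.
move=> phi0; apply/val_inj/funext => x /=.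
by apply/eqP; rewrite -normr_le0 (le_trans (dual_normP _ _))// phi0 mul0r.
Qed.

HB.instance Definition _ :=
  Lmodule_isNormed.Build R dual dual_normD dual_normZ dual_norm0_eq0.

End dual_space.

(* The canonical embedding J : X -> X**, (J x)(phi) = phi x. *)
Section bidual.
Context {R : realType} (X : normedModType R).

Lemma eval_continuous_linear_form (x : X) :
  (fun phi : dual X => phi x : R^o) \in @continuous_linear_form R (dual X).
Proof.
apply/asboolP; split; first by move=> a phi psi.
pose ev : dual X -> R^o := fun phi => phi x.
pose lev := HB.pack_for {linear dual X -> R^o} ev
  (GRing.isLinear.Build R (dual X) R^o *:%R ev
     (fun a phi psi => erefl : ev (a *: phi + psi) = a *: ev phi + ev psi)).
apply: (@bounded_linear_continuous R (dual X) R^o lev).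
apply/bounded_funP => r; exists (r * `|x|) => phi phir.
by rewrite (le_trans (dual_normP _ _))// ler_wpM2r.
Qed.

Definition bidual_embedding (x : X) : dual (dual X) :=
  Dual (eval_continuous_linear_form x).

End bidual.

(* [weak_star Y] is the dual of [Y] with the topology sigma(Y*, Y), so that
   [weak_star (dual X)] is the bidual of [X] with the topology w**. *)
Definition weak_star {R : realType} (Y : normedModType R) :=
  initial_topology (fun phi : dual Y => (phi : {ptws Y -> R^o})).

Section extended_real_functions.
Context {R : realType} (X : normedModType R).
Implicit Types f : X -> \bar R.
Local Open Scope ereal_scope.

Definition edom f : set X := [set x | f x < +oo].

Definition econvex f := forall (x y : X) (t : R), (0 < t < 1)%R ->
  f (t *: x + (1 - t) *: y)%R <= t%:E * f x + (1 - t)%:E * f y.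

Definition Gamma0 f := [/\ forall x, f x != -oo, edom f !=set0,
  lower_semicontinuous f & econvex f].

Definition conjugate f (phi : dual X) : \bar R :=
  ereal_sup [set (phi x)%:E - f x | x in setT].

Definition subdifferential f (x : X) : set (dual X) :=
  [set phi | f x \is a fin_num /\ conjugate f phi + f x <= (phi x)%:E].

(* The w**-lower semicontinuous hull of the extension of [f] by +oo outside
   [X]: all the w**-neighborhoods of the origin are used as a basis. *)
Definition weak_star_hull f (xi : dual (dual X)) : \bar R :=
  ereal_sup [set ereal_inf (f @` [set y | U (bidual_embedding y - xi)%R])
            | U in nbhs ((0 : dual (dual X))%R : weak_star (dual X))].

End extended_real_functions.

(* Main.v *)
Require Import Defs.
From HB Require Import structures.
From mathcomp Require Import all_boot all_order all_algebra.
From mathcomp Require Import all_classical all_reals.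
From mathcomp Require Import ereal topology normedtype sequences.
From mathcomp Require Import zify ring lra.
Import Order.TTheory GRing.Theory Num.Theory.
Import numFieldNormedType.Exports.
Local Open Scope classical_set_scope.
Local Open Scope ring_scope.

(** For [h] in [Gamma0 X] the w**-lower semicontinuous hull of [h] is the
    biconjugate of [h] ([affine_minorant_hull], [hull_affine_minorant]), and the
    hull of [f + g] is always at least the sum of the hulls ([hull_add_le]).
    Equality of the hulls thus says that the conjugate of [f + g] is the
    norm-lower semicontinuous hull of the infimal convolution of the conjugates
    of [f] and [g].

    Suppose that the hulls are equal and let [xs] be a subgradient of [f + g] at
    [x]. By separation in the dual, [xs] is a norm limit of sums [u + v] of
    [e]-subgradients of [f] and [g] at [x] ([hull_sum_approx]). To replace them
    by exact subgradients at nearby points, Ekeland's principle is applied on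
    [X * X] to [f a + g b - u a - v b], with the perturbation
    [e (|h| + |k| + |u (h - k)|)] ([exact_subgradients]). The norms of [u] and
    [v] are not under control. The last term of the perturbation compensates for
    this: on the diagonal it vanishes, so the sum of the two corrections has norm
    at most [2 e], and it makes [u (a - b)] small, so the sum of the pairings
    [a' (a - x) + b' (b - x)] tends to 0. As [f a - f x <= a' (a - x)], and
    likewise for [g], lower semicontinuity makes each pairing tend to 0 and gives
    the convergence of the values ([sum_rule_of_hull]).

    Conversely, by the Broendsted-Rockafellar theorem
    ([broendsted_rockafellar]), the biconjugate of [f + g] is determined by the
    subgradients of [f + g]. The sum rule approximates such a subgradient by
    [u + v] in such a way that the sum of the conjugates of [f] at [u] and of [g]
    at [v] is nearly at most the conjugate of [f + g]; so the biconjugate of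
    [f + g] is at most the sum of the biconjugates ([hull_of_sum_rule]).

    All separation arguments rest on the Mazur-Orlicz sandwich theorem
    ([mazur_orlicz]), proved by taking a minimal sublinear functional. *)

Set Implicit Arguments.
Unset Strict Implicit.
Unset Printing Implicit Defensive.

(** * The sandwich theorem *)

Section sublinear_functionals.
Context {R : realType} {V : lmodType R}.
Implicit Types (p q : V -> R) (v w : V) (A : set (V * R)).

(** Sublinear functionals: subadditive and positively homogeneous. *)
Definition sublinear p :=
  (forall v w, p (v + w) <= p v + p w) /\
  (forall (t : R) v, 0 <= t -> p (t *: v) = t * p v).

(** Convexity of a subset of [V * R]; such sets are used below as convex sets
    of constraints [r <= l v] to be imposed on a linear functional [l]. *)
Definition convex_subset A := forall v w r s t, 0 <= t <= 1 ->
  A (v, r) -> A (w, s) -> A (t *: v + (1 - t) *: w, t * r + (1 - t) * s).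

Lemma sublinear0 p : sublinear p -> p 0 = 0.
Proof. by move=> [_ /(_ 0 0 (lexx _))]; rewrite scale0r mul0r. Qed.

Lemma sublinear_opp_le p v : sublinear p -> - p (- v) <= p v.
Proof.
move=> sp; have [pD _] := sp.
by have := pD v (- v); rewrite subrr sublinear0//; lra.
Qed.

(** A sublinear majorant of the constraints [A] can be lowered to a sublinear
    [q] such that every [l <= q] which is odd satisfies them: the witness is
    [q v = inf (p (v + t w) - t r)] over [t >= 0] and [(w, r)] in [A]. *)
Lemma sublinear_push p A : sublinear p -> convex_subset A -> A !=set0 ->
  (forall v r, A (v, r) -> r <= p v) ->
  exists q, [/\ sublinear q, forall v, q v <= p v &
    forall v r, A (v, r) -> q (- v) <= - r].
Proof.
move=> sp cA [[w0 r0] A0] Ap; have [pD pZ] := sp.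
pose S v := [set z | exists (t : R) w (r : R),
  [/\ 0 <= t, A (w, r) & z = p (v + t *: w) - t * r]].
pose q v : R := inf (S v).
have Slb v z : S v z -> - p (- v) <= z.
  move=> [t [w [r [t0 /Ap Awr ->]]]].
  have := pD (v + t *: w) (- v); rewrite addrAC subrr add0r pZ//.
  have : t * r <= t * p w by exact: ler_wpM2l.
  by lra.
have S0 v : S v !=set0.
  by exists (p (v + 0 *: w0) - 0 * r0), 0, w0, r0.
have qle v (t : R) w (r : R) : 0 <= t -> A (w, r) -> q v <= p (v + t *: w) - t * r.
  by move=> t0 Awr; apply: ge_inf; [exists (- p (- v)) => z; exact: Slb|exists t, w, r].
have qge v (c : R) :
    (forall (t : R) w (r : R), 0 <= t -> A (w, r) -> c <= p (v + t *: w) - t * r) ->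
    c <= q v.
  by move=> H; apply: lb_le_inf => // _ [t [w [r [t0 Awr ->]]]]; exact: H.
exists q; split; first split.
- move=> v1 v2.
  rewrite -lerBlDr; apply: (@qge _ _) => t1 w1 r1 t10 A1.
  rewrite lerBlDr [leRHS]addrC -lerBlDr; apply: (@qge _ _) => t2 w2 r2 t20 A2.
  rewrite lerBlDr.
  have [t0|t0] := eqVneq (t1 + t2) 0.
    have -> : t1 = 0 by lra.
    have -> : t2 = 0 by lra.
    rewrite !scale0r !mul0r !addr0 !subr0.
    apply: le_trans (qle _ 0 w0 r0 (lexx _) A0) _.
    by rewrite scale0r addr0 mul0r subr0 addrC.
  have tp : 0 < t1 + t2 by rewrite lt_neqAle eq_sym t0 addr_ge0.
  pose t := t1 / (t1 + t2).
  have t1E : (t1 + t2) * t = t1 by rewrite /t mulrCA divff// mulr1.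
  have t01 : 0 <= t <= 1.
    by rewrite /t divr_ge0 ?ler_pdivrMr ?(ltW tp)//= mul1r lerDl.
  have t2E : (t1 + t2) * (1 - t) = t2 by rewrite mulrBr t1E mulr1 addrC addKr.
  clearbody t.
  have wE : (t1 + t2) *: (t *: w1 + (1 - t) *: w2) = t1 *: w1 + t2 *: w2.
    by rewrite scalerDr !scalerA t1E t2E.
  have rE : (t1 + t2) * (t * r1 + (1 - t) * r2) = t1 * r1 + t2 * r2.
    by rewrite [LHS]mulrDr !(mulrA (t1 + t2)) t1E t2E.
  have := qle (v1 + v2) (t1 + t2) _ _ (ltW tp) (cA _ _ _ _ _ t01 A1 A2).
  rewrite wE rE => /le_trans; apply.
  have := pD (v1 + t1 *: w1) (v2 + t2 *: w2).
  by rewrite addrACA; lra.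
- have qpos t v : 0 < t -> q (t *: v) <= t * q v.
    move=> t0; rewrite -ler_pdivrMl//; apply: (@qge _ _) => s w r s0 Awr.
    rewrite ler_pdivrMl//.
    apply: le_trans (qle _ (t * s) _ _ (mulr_ge0 (ltW t0) s0) Awr) _.
    by rewrite -scalerA -scalerDr pZ ?(ltW t0)// mulrBr mulrA.
  move=> t v; rewrite le_eqVlt => /predU1P[<-|t0].
    rewrite scale0r mul0r; apply/eqP; rewrite eq_le; apply/andP; split.
      apply: le_trans (qle _ 0 w0 r0 (lexx _) A0) _.
      by rewrite scale0r addr0 mul0r subr0 sublinear0.
    by apply: lb_le_inf => // z /Slb; rewrite oppr0 (sublinear0 sp) oppr0.
  apply/eqP; rewrite eq_le qpos//=.
  have := qpos t^-1 (t *: v); rewrite invr_gt0 => /(_ t0).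
  by rewrite scalerK ?gt_eqF// ler_pdivlMl.
- move=> v; apply: le_trans (qle _ 0 w0 r0 (lexx _) A0) _.
  by rewrite scale0r addr0 mul0r subr0.
- move=> v r Avr; apply: le_trans (qle _ 1 v r ler01 Avr) _.
  by rewrite scale1r addNr sublinear0// mul1r sub0r.
Qed.

(** By Zorn's lemma, since the infimum of a chain of sublinear functionals
    below [p] is sublinear; it is finite because [- p (- v) <= q v] as soon as
    [q <= p]. *)
Lemma sublinear_minimal p : sublinear p ->
  exists q, [/\ sublinear q, forall v, q v <= p v &
    forall q', sublinear q' -> (forall v, q' v <= q v) -> q' = q].
Proof.
move=> sp.
pose T := {q : V -> R | sublinear q /\ forall v, q v <= p v}.
pose ge (a b : T) := `[< forall v, sval b v <= sval a v >].
have Teq (a b : T) : sval a = sval b -> a = b.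
  by exact: eq_sig_hprop => ? ? ?; exact: Prop_irrelevance.
have [| | | |m mmin] := @Zorn T ge.
- by move=> a; apply/asboolP.
- by move=> a b c /asboolP ab /asboolP bc; apply/asboolP => v; exact: le_trans (bc v) (ab v).
- by move=> a b /asboolP ab /asboolP ba; apply/Teq/funext => v; apply/eqP; rewrite eq_le ab ba.
- move=> C Ctot; have [C0|C0] := pselect (C !=set0); last first.
    exists (exist _ p (conj sp (fun v => lexx (p v))) : T) => s Cs.
    by exfalso; apply: C0; exists s.
  (* The pointwise infimum of the chain is an upper bound for the reversed order. *)
  pose S v := [set sval a v | a in C].
  have Slb v z : S v z -> - p (- v) <= z.
    move=> [[q [sq qp]] _ <-] /=.
    by have := sublinear_opp_le v sq; have := qp (- v); lra.
  have Sle v a : C a -> inf (S v) <= sval a v.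
    by move=> Ca; apply: ge_inf; [exists (- p (- v)) => z; exact: Slb|exists a].
  have leS v c : (forall a, C a -> c <= sval a v) -> c <= inf (S v).
    move=> H; apply: lb_le_inf; first by have [a Ca] := C0; exists (sval a v), a.
    by move=> _ [a Ca <-]; exact: H.
  have si : sublinear (fun v => inf (S v)).
    split.
      move=> v w; rewrite -lerBlDr; apply: (@leS _ _) => a Ca.
      rewrite lerBlDr [leRHS]addrC -lerBlDr; apply: (@leS _ _) => b Cb; rewrite lerBlDr.
      have [/asboolP ab|/asboolP ba] := Ctot _ _ Ca Cb.
        apply: le_trans (Sle _ _ Cb) _; have [[bD _] _] := svalP b.
        by have := ab v; have := bD v w; lra.
      apply: le_trans (Sle _ _ Ca) _; have [[aD _] _] := svalP a.
      by have := ba w; have := aD v w; lra.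
    move=> t v t0; have [->|tn0] := eqVneq t 0.
      rewrite scale0r mul0r; apply/eqP; rewrite eq_le; apply/andP; split.
        have [a Ca] := C0; apply: le_trans (Sle _ _ Ca) _.
        by rewrite (sublinear0 (svalP a).1).
      by apply: (@leS _ _) => a Ca; rewrite (sublinear0 (svalP a).1).
    have tp : 0 < t by rewrite lt_neqAle eq_sym tn0.
    apply/eqP; rewrite eq_le; apply/andP; split.
      rewrite -ler_pdivrMl//; apply: (@leS _ _) => a Ca; rewrite ler_pdivrMl//.
      by rewrite -((svalP a).1.2 _ _ t0); exact: Sle.
    apply: (@leS _ _) => a Ca; rewrite ((svalP a).1.2 _ _ t0).
    by rewrite ler_wpM2l// Sle.
  have ip v : inf (S v) <= p v.
    by have [a Ca] := C0; apply: le_trans (Sle _ _ Ca) _; exact: (svalP a).2.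
  exists (exist _ (fun v => inf (S v)) (conj si ip) : T) => a Ca.
  by apply/asboolP => v; exact: Sle.
- case: m mmin => q [sq qp] mmin; exists q; split=> // q' sq' q'q.
  have q'p v : q' v <= p v by exact: le_trans (q'q v) (qp v).
  have /asboolP/mmin/(congr1 sval) // : forall v, sval (exist _ q' (conj sq' q'p) : T) v <= q v.
  exact: q'q.
Qed.

(** The Mazur-Orlicz sandwich theorem, the only form of the Hahn-Banach theorem
    used in this file. The linear functional is a minimal sublinear one: lowering
    it at the constraint [(w, m w)] leaves it unchanged, which makes it odd. *)
Theorem mazur_orlicz p A : sublinear p -> convex_subset A -> A !=set0 ->
  (forall v r, A (v, r) -> r <= p v) ->
  exists l : {linear V -> R^o}, (forall v, l v <= p v) /\
    forall v r, A (v, r) -> r <= l v.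
Proof.
move=> sp cA A0 Ap.
have [q [sq qp qA]] := sublinear_push sp cA A0 Ap.
have [m [sm mq mmin]] := sublinear_minimal sq.
have [mD mZ] := sm.
have mN w : m (- w) = - m w.
  pose B : set (V * R) := [set x | x = (w, m w)].
  have [|||q' [sq' q'm q'B]] := @sublinear_push m B sm.
  - move=> v1 v2 r s t t01 [-> ->] [-> ->].
    by rewrite -scalerDl -mulrDl addrC subrK scale1r mul1r.
  - by exists (w, m w).
  - by move=> v r [-> ->].
  rewrite (mmin _ sq' q'm) in q'B.
  apply/eqP; rewrite eq_le q'B//=.
  by have := sublinear_opp_le (- w) sm; rewrite opprK; lra.
have mDe v w : m (v + w) = m v + m w.
  apply/eqP; rewrite eq_le mD/=.
  by have := mD (- v) (- w); rewrite -opprD !mN; lra.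
have mlin : linear (m : V -> R^o).
  move=> a v w; rewrite mDe; congr (_ + _).
  have [a0|a0] := leP 0 a; first by rewrite mZ.
  rewrite -[a]opprK scaleNr mN mZ ?oppr_ge0 ?ltW//.
  by rewrite [RHS]mulNr.
pose L := HB.pack_for {linear V -> R^o} (m : V -> R^o)
  (GRing.isLinear.Build R V R^o *:%R (m : V -> R^o) mlin).
exists L; split=> [v|v r Avr]; first by exact: le_trans (mq v) (qp v).
have := qA _ _ Avr; have := mq (- v); rewrite mN /=.
by rewrite /L/=; lra.
Qed.

End sublinear_functionals.

(** * Ekeland's variational principle *)

Section ekeland.
Context {R : realType}.

(** Convergence, Cauchy sequences and completeness with respect to a seminorm
    [p] given as a plain function, so that several seminorms can be put on the
    same space. *)
Definition seminorm_cvg {V : zmodType} (p : V -> R) (u : nat -> V) (l : V) :=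
  forall e, 0 < e -> exists N, forall n, (N <= n)%N -> p (u n - l) <= e.

Definition seminorm_cauchy {V : zmodType} (p : V -> R) (u : nat -> V) :=
  forall e, 0 < e -> exists N, forall n m, (N <= n)%N -> (n <= m)%N ->
    p (u n - u m) <= e.

Definition seminorm_complete {V : zmodType} (p : V -> R) :=
  forall u, seminorm_cauchy p u -> exists l, seminorm_cvg p u l.

(** Sequential lower semicontinuity, with respect to [p], of the function equal
    to [F] on [D] and to [+oo] outside [D]. *)
Definition closed_sublevels {V : zmodType} (p : V -> R) (D : set V) (F : V -> R) :=
  forall u l r, seminorm_cvg p u l -> (forall n, D (u n) /\ F (u n) <= r) ->
    D l /\ F l <= r.

(** Ekeland's variational principle for the function equal to [F] on [D] and to
    [+oo] outside [D], with the perturbation measured by [p]. *)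
Theorem ekeland {V : zmodType} (p : V -> R) (D : set V) (F : V -> R) z0 m :
  p 0 = 0 -> (forall v, p (- v) = p v) -> (forall v w, p (v + w) <= p v + p w) ->
  seminorm_complete p -> closed_sublevels p D F ->
  (forall z, D z -> m <= F z) -> D z0 ->
  exists z, [/\ D z, F z + p (z - z0) <= F z0 &
    forall w, D w -> F z <= F w + p (w - z)].
Proof.
move=> p0 pN pD pc Fc Fm Dz0.
have p_ge0 v : 0 <= p v by have := pD v (- v); rewrite subrr p0 pN; lra.
have pS v w : p (v - w) = p (w - v) by rewrite -pN opprB.
have pT v w x : p (v - x) <= p (v - w) + p (w - x).
  by apply: le_trans (pD _ _); rewrite addrA subrK.
(* The n-th step picks, among the points [w] with [F w + p (w - z) <= F z], one
   that minimizes [F] up to [1 / (n + 1)]. *)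
have step (nz : nat * V) : exists z',
    D nz.2 -> [/\ D z', F z' + p (z' - nz.2) <= F nz.2 &
    forall w, D w -> F w + p (w - nz.2) <= F nz.2 -> F z' <= F w + nz.1.+1%:R^-1].
  case: nz => n z /=; have [Dz|] := pselect (D z); last by exists z.
  pose S := [set F w | w in [set w | D w /\ F w + p (w - z) <= F z]].
  have hS : has_inf S.
    split; first by exists (F z), z => //; split => //; rewrite subrr p0 addr0.
    by exists m => _ [w [Dw _] <-]; exact: Fm.
  have n0 : 0 < n.+1%:R^-1 :> R by rewrite invr_gt0.
  have [_ [z' [Dz' z'z] <-] z'S] := inf_adherent n0 hS.
  exists z' => _; split=> // w Dw wz; apply: (le_trans (ltW z'S)).
  by rewrite lerD2r; apply: ge_inf; [exact: hS.2|exists w].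
have [st stP] := choice step.
pose u := fix u n := if n is k.+1 then st (k, u k) else z0.
have Du n : D (u n) by elim: n => [//|n IH]; have [] := stP (n, u n) IH.
have uS n : F (u n.+1) + p (u n.+1 - u n) <= F (u n).
  by have [] := stP (n, u n) (Du n).
have uopt n w : D w -> F w + p (w - u n) <= F (u n) -> F (u n.+1) <= F w + n.+1%:R^-1.
  by have [_ _] := stP (n, u n) (Du n); apply.
have umono n k : F (u (n + k)%N) + p (u (n + k)%N - u n) <= F (u n).
  elim: k => [|k IH]; first by rewrite addn0 subrr p0 addr0.
  rewrite addnS; have := uS (n + k)%N; have := pT (u (n + k).+1) (u (n + k)%N) (u n).
  by move: IH; lra.
have ucauchy : seminorm_cauchy p u.
  move=> e e0.
  pose S := [set F (u n) | n in setT].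
  have hS : has_inf S.
    by split; [exists (F (u 0%N)), 0%N|exists m => _ [n _ <-]; exact: Fm].
  have [_ [N _ <-] NS] := inf_adherent e0 hS.
  exists N => n k Nn nk; rewrite pS.
  have := umono n (k - n)%N; rewrite subnKC// => H.
  have : inf S <= F (u k) by apply: ge_inf; [exact: hS.2|exists k].
  have := umono N (n - N)%N; rewrite subnKC// => H1.
  have := p_ge0 (u n - u N).
  by lra.
have [l ul] := pc _ ucauchy.
have Fl n : D l /\ F l + p (l - u n) <= F (u n).
  have shift k : seminorm_cvg p (fun i => u (k + i)%N) l.
    move=> e /ul[N HN]; exists N => i Ni; apply: HN.
    by rewrite (leq_trans Ni)// leq_addl.
  have Dl : D l.
    have [] // := Fc _ _ (F (u 0%N)) (shift 0%N) _.
    move=> i; split=> //; have := umono 0%N i.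
    have := p_ge0 (u (0 + i)%N - u 0%N).
    by lra.
  split=> //; apply/ler_addgt0Pr => e e0.
  have [N HN] := ul _ e0.
  rewrite -lerBrDr.
  have [//|_ +] := Fc _ _ (F (u n) + e - p (l - u n)) (shift (n + N)%N); last by lra.
  move=> i; split=> //; have := umono n (N + i)%N; rewrite addnA.
  have /HN : (N <= n + N + i)%N by rewrite addnAC leq_addl.
  by have := pT l (u (n + N + i)%N) (u n); rewrite (pS l (u (n + N + i)%N)); lra.
exists l; split; [exact: (Fl 0%N).1|exact: (Fl 0%N).2|].
move=> w Dw; rewrite leNgt; apply/negP => wl.
have pwl := p_ge0 (w - l).
suff : F l <= F w by lra.
apply/ler_addgt0Pr => e e0.
have [n _ ne] := near_infty_natSinv_lt (PosNum e0).
have ne' : n.+1%:R^-1 < e := ne n (leqnn n).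
have : F (u n.+1) <= F w + e.
  apply: le_trans (uopt n w Dw _) _; last by rewrite lerD2l ltW.
  have [_ ] := Fl n.
  by have := pT w l (u n); lra.
have [_] := Fl n.+1.
have := p_ge0 (l - u n.+1).
by lra.
Qed.

End ekeland.

(** * Convex functions and linear subgradients *)

Section convex_functions.
Context {R : realType}.

(** Convexity of the function equal to [F] on [D] and to [+oo] outside [D]. *)
Definition convex_on {V : lmodType R} (D : set V) (F : V -> R) :=
  forall v w t, 0 <= t <= 1 -> D v -> D w ->
    D (t *: v + (1 - t) *: w) /\
    F (t *: v + (1 - t) *: w) <= t * F v + (1 - t) * F w.

(** If [F + p (_ - z)] is bounded below by [c], the sublinear [p] may be replaced
    by a linear functional. *)
Lemma convex_on_sandwich {V : lmodType R} (D : set V) (F : V -> R) (p : V -> R) z c :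
  sublinear p -> convex_on D F -> D !=set0 ->
  (forall w, D w -> c <= F w + p (w - z)) ->
  exists l : {linear V -> R^o}, (forall v, l v <= p v) /\
    forall w, D w -> c <= F w + l (w - z).
Proof.
move=> sp cF [w0 Dw0] zmin.
pose A : set (V * R) := [set x | D (z + x.1) /\ x.2 <= c - F (z + x.1)].
have [||v r [/= Dv rv]|l [lp lA]] := @mazur_orlicz _ _ p A sp.
- move=> v w r s t t01 [/= Dv rv] [/= Dw rw].
  have [] := cF _ _ _ t01 Dv Dw.
  have -> : t *: (z + v) + (1 - t) *: (z + w) = z + (t *: v + (1 - t) *: w).
    by rewrite !scalerDr addrACA -scalerDl (addrC t) subrK scale1r.
  move=> D' F'; split=> //=.
  apply: (@le_trans _ _ (t * (c - F (z + v)) + (1 - t) * (c - F (z + w)))).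
    by have /andP[t0 t1] := t01; rewrite lerD// ler_wpM2l// subr_ge0.
  by move: F'; nra.
- by exists (w0 - z, c - F w0); split => /=; rewrite (addrC z) subrK.
- by have := zmin _ Dv; rewrite (addrC z v) addrK addrC in rv *; lra.
exists l; split=> // w Dw; have := lA (w - z) (c - F w).
by rewrite /A/= (addrC z) subrK => /(_ (conj Dw (lexx _))); lra.
Qed.

(** Ekeland's principle followed by the sandwich theorem: near any [z0] there is
    a point where [F] has a linear subgradient dominated by [p]. *)
Theorem ekeland_subgradient {V : lmodType R} (p : V -> R) (D : set V) (F : V -> R) z0 m :
  sublinear p -> (forall v, p (- v) = p v) ->
  seminorm_complete p -> closed_sublevels p D F -> convex_on D F ->
  (forall z, D z -> m <= F z) -> D z0 ->
  exists z (l : {linear V -> R^o}), [/\ D z, F z + p (z - z0) <= F z0,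
    forall v, l v <= p v & forall w, D w -> F z <= F w + l (w - z)].
Proof.
move=> sp pN pc Fc cF Fm Dz0; have [pD _] := sp.
have [z [Dz zz0 zmin]] := ekeland (sublinear0 sp) pN pD pc Fc Fm Dz0.
have [l [lp lz]] := convex_on_sandwich sp cF (ex_intro _ z Dz) zmin.
by exists z, l.
Qed.

End convex_functions.

(** * Continuous linear forms *)

Section dual_facts.
Context {R : realType} {X : normedModType R}.

Lemma bounded_linear_dual (l0 : X -> R^o) M : linear l0 ->
  (forall x, (l0 x : R) <= M * `|x|) -> exists phi : dual X, forall x, phi x = l0 x.
Proof.
move=> lin lM.
pose l := HB.pack_for {linear X -> R^o} l0 (GRing.isLinear.Build R X R^o *:%R l0 lin).
have lc : continuous l0.
  apply: (@bounded_linear_continuous R X R^o l); apply/bounded_funP => r.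
  exists (`|M| * `|r|) => x xr.
  have nx (y : X) : `|y| <= r -> M * `|y| <= `|M| * `|r|.
    move=> yr; apply: le_trans (ler_norm _) _; rewrite normrM ler_pM// normr_id.
    exact: le_trans yr (ler_norm _).
  suff : `|(l0 x : R)| <= `|M| * `|r| by [].
  rewrite ler_norml; apply/andP; split; last exact: le_trans (lM x) (nx _ xr).
  have xNr : `|- x| <= r by rewrite normrN.
  have l0N : l0 (- x) = - l0 x := linearN l x.
  by have := le_trans (lM (- x)) (nx _ xNr); rewrite l0N lerNl.
have lP : l0 \in @continuous_linear_form R X.
  exact/asboolP.
by exists (Dual lP).
Qed.

Lemma dual_norm_le_linear (phi : dual X) M : 0 <= M ->
  (forall x, (phi x : R) <= M * `|x|) -> `|phi| <= M.
Proof.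
move=> M0 H; apply: dual_norm_le => x x1.
have xM : M * `|x| <= M by rewrite ler_piMr.
suff : `|(phi x : R)| <= M by [].
rewrite ler_norml; apply/andP; split; last exact: le_trans (H x) xM.
by have := H (- x); rewrite normrN => /le_trans/(_ xM); rewrite linearN/= lerNl.
Qed.

Lemma dual_ler_norm (phi : dual X) x : `|phi x| <= `|phi| * `|x|.
Proof. exact: dual_normP. Qed.

Lemma dualDE (phi psi : dual X) x : (phi + psi) x = phi x + psi x.
Proof. by []. Qed.

Lemma dualNE (phi : dual X) x : (- phi) x = - phi x.
Proof. by []. Qed.

Lemma dualZE a (phi : dual X) x : (a *: phi) x = a * phi x.
Proof. by []. Qed.

Lemma dual_sumE (I : Type) (s : seq I) (phi : I -> dual X) x :
  (\sum_(i <- s) phi i) x = \sum_(i <- s) phi i x.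
Proof.
by elim/big_rec2 : _ => [//|i y z _ <-]; rewrite dualDE.
Qed.

End dual_facts.

Section complete.
Context {R : realType} {X : completeNormedModType R}.

Lemma norm_complete : seminorm_complete (fun x : X => `|x|).
Proof.
move=> u uc.
have : cvgn u.
  apply/cauchy_cvgP/cauchy_ballP => e e0.
  have e20 : 0 < e / 2 by rewrite divr_gt0.
  have [N HN] := uc _ e20.
  pose S := u @` [set n | (N <= n)%N].
  exists (S, S).
    by split; exists N => //= n Nn; exists n.
  move=> [_ _] [[n /= Nn <-] [m /= Nm <-]]; rewrite -ball_normE /ball_/=.
  apply: (@le_lt_trans _ _ (e / 2)); last by rewrite ltr_pdivrMr// mulr_natr mulr2n ltrDl.
  have [nm|/ltnW mn] := leqP n m; first exact: HN.
  by rewrite distrC; exact: HN.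
move=> /cvg_ex[l ul]; exists l => e e0.
have /cvgrPdist_le/(_ e e0)[N _ HN] := ul.
by exists N => n Nn; rewrite distrC; exact: HN.
Qed.

End complete.

(** * Functions of the class Gamma0 and their affine minorants *)

Section ereal_facts.
Context {R : realType}.
Local Open Scope ereal_scope.

(** A strict lower bound of a sum is split into strict lower bounds of the two
    terms; infinite terms are allowed. *)
Lemma lte_split (A B : \bar R) (c : R) : A != -oo -> B != -oo -> c%:E < A + B ->
  exists a b : R, [/\ a%:E < A, b%:E < B & (c <= a + b)%R].
Proof.
case: A => [A| |] // _; case: B => [B| |] // _.
- rewrite -EFinD lte_fin => cAB.
  exists (A - (A + B - c) / 2)%R, (B - (A + B - c) / 2)%R.
  by rewrite !lte_fin; split; lra.
- by exists (A - 1)%R, (c - A + 1)%R; rewrite lte_fin ltry; split=> //; lra.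
- by exists (c - B + 1)%R, (B - 1)%R; rewrite lte_fin ltry; split=> //; lra.
- by exists c, 0%R; rewrite !ltry addr0.
Qed.

Lemma lee_real_lt (A B : \bar R) : (forall r : R, r%:E < A -> r%:E <= B) -> A <= B.
Proof.
move=> H; rewrite leNgt; apply/negP => BA.
have [r Br rA] : exists2 r : R, B < r%:E & r%:E < A.
  move: A B BA {H} => [A| |] [B| |] //.
  - rewrite lte_fin => BA; exists ((A + B) / 2)%R; rewrite lte_fin; lra.
  - by move=> _; exists (A - 1)%R; rewrite ?ltNyr// lte_fin; lra.
  - by move=> _; exists (B + 1)%R; rewrite ?ltry// lte_fin; lra.
  - by move=> _; exists 0%R; rewrite ?ltry ?ltNyr.
by have := H _ rA; rewrite leNgt Br.
Qed.

End ereal_facts.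

Section Gamma0_facts.
Context {R : realType} {X : normedModType R}.
Implicit Types (f g : X -> \bar R) (u v : dual X).

(** [u - c] is an affine minorant of [f], that is, the conjugate of [f] at [u] is
    at most [c]. Conjugates are handled through this relation only, which keeps
    all computations in the reals. *)
Definition affine_minorant f u (c : R) := forall x, ((u x - c)%:E <= f x)%E.

Lemma Gamma0_fineK f x : Gamma0 f -> edom f x -> f x = (fine (f x))%:E.
Proof.
by move=> [fN _ _ _] fx; rewrite fineK// fin_numE fN lt_eqF.
Qed.

Lemma Gamma0_convex_on f : Gamma0 f -> convex_on (edom f) (fine \o f).
Proof.
move=> Gf; have [_ _ _ cf] := Gf.
move=> x y t /andP[t0 t1] fx fy /=.
have [->|tn0] := eqVneq t 0.
  by rewrite !scale0r subr0 !scale1r !mul0r !add0r mul1r.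
have [->|tn1] := eqVneq t 1.
  by rewrite subrr !scale0r !scale1r !mul0r !addr0 mul1r.
have t01 : 0 < t < 1 by rewrite !lt_neqAle eq_sym tn0 tn1 t0 t1.
have := cf x y t t01.
rewrite (Gamma0_fineK Gf fx) (Gamma0_fineK Gf fy) -!EFinM -EFinD => H.
have D : edom f (t *: x + (1 - t) *: y) by apply: (le_lt_trans H); rewrite ltry.
by split=> //; move: H; rewrite (Gamma0_fineK Gf D) lee_fin.
Qed.

Lemma Gamma0_lsc_seq f (s : nat -> X) l (c : R) : Gamma0 f ->
  seminorm_cvg (fun x => `|x|) s l -> (c%:E < f l)%E ->
  exists N, forall n, (N <= n)%N -> (c%:E < f (s n))%E.
Proof.
move=> [_ _ lf _] sl cfl; have [V /nbhs_normP[e /= e0 eV] Vc] := lf _ _ cfl.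
have e20 : 0 < e / 2 by rewrite divr_gt0.
have [N HN] := sl _ e20; exists N => n /HN H; apply/Vc/eV => /=.
by rewrite distrC; lra.
Qed.

Lemma Gamma0_add f g : Gamma0 f -> Gamma0 g -> edom f `&` edom g !=set0 ->
  Gamma0 (f \+ g)%E.
Proof.
move=> Gf Gg [x0 [fx0 gx0]].
have [fN _ lf cf] := Gf; have [gN _ lg cg] := Gg.
split.
- by move=> x; rewrite adde_eq_ninfty negb_or fN gN.
- by exists x0; rewrite /edom /= lte_add_pinfty.
- move=> x c /(lte_split (fN x) (gN x))[a [b [afx bgx cab]]].
  have [V Vx Va] := lf _ _ afx; have [W Wx Wb] := lg _ _ bgx.
  exists (V `&` W); first exact: filterI.
  move=> y [/Va ay /Wb bY]; apply: (@le_lt_trans _ _ (a%:E + b%:E)%E).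
    by rewrite -EFinD lee_fin.
  exact: lteD.
- move=> x y t t01; have /andP[t0 t1] := t01.
  have := leeD (cf x y t t01) (cg x y t t01); move=> /le_trans; apply.
  have def z : (f z +? g z)%E by rewrite ltninfty_adde_def// inE ltNye ?fN ?gN.
  by rewrite addeACA !muleDr.
Qed.

(** Lower semicontinuity at a point [x0] of the domain bounds [f] from below near
    [x0]; by convexity [f] then decreases at most linearly away from [x0], and
    the sandwich theorem turns the cone obtained into an affine function. *)
Lemma Gamma0_affine_minorant f : Gamma0 f -> exists u c, affine_minorant f u c.
Proof.
move=> Gf; have [fN [x0 fx0] lf _] := Gf.
have [V /nbhs_normP[e /= e0 eV] Vc] : exists2 V, nbhs x0 V &
    forall y, V y -> ((fine (f x0) - 1)%:E < f y)%E.
  by apply: lf; rewrite [ltRHS](Gamma0_fineK Gf fx0) lte_fin; lra.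
pose K := (e / 2)^-1.
have e20 : 0 < e / 2 by rewrite divr_gt0.
have K0 : 0 < K by rewrite invr_gt0.
have sK : sublinear (fun x : X => K * `|x|).
  split=> [x y|t x t0]; first by rewrite -mulrDr ler_pM2l// ler_normD.
  by rewrite normrZ ger0_norm// mulrCA.
have lb y : edom f y -> fine (f x0) - 1 <= fine (f y) + K * `|y - x0|.
  move=> fy.
  have K_ge0 : 0 <= K * `|y - x0| by rewrite mulr_ge0// ltW.
  have [ye|ye] := ltP `|y - x0| e.
    have /eV/Vc : `|x0 - y| < e by rewrite distrC.
    by rewrite (Gamma0_fineK Gf fy) lte_fin; lra.
  have y0 : 0 < `|y - x0| by exact: lt_le_trans ye.
  (* [z] lies on the segment from [x0] to [y], at distance [e / 2] from [x0]. *)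
  pose s := (e / 2) / `|y - x0|.
  have s0 : 0 < s by rewrite divr_gt0.
  have s01 : 0 <= s <= 1 by rewrite ltW//= ler_pdivrMr// mul1r; lra.
  have [fz] := Gamma0_convex_on Gf s01 fy fx0.
  set z := _ + _ in fz * => /= Hz.
  have /eV/Vc : `|x0 - z| < e.
    have -> : x0 - z = - (s *: (y - x0)).
      by rewrite /z scalerBl scale1r addrCA -scalerBr opprD addrA subrr sub0r.
    by rewrite normrN normrZ gtr0_norm// /s divfK ?gt_eqF//; lra.
  rewrite (Gamma0_fineK Gf fz) lte_fin => Hz'.
  have KsE : K * `|y - x0| = s^-1 by rewrite /s [RHS]invfM invrK.
  by rewrite KsE -(ler_pM2l s0) [leRHS]mulrDr divff ?gt_eqF//; move: Hz Hz'; lra.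
have [|l [lp lx]] := convex_on_sandwich sK (Gamma0_convex_on Gf) _ lb.
  by exists x0.
have [phi phiE] := bounded_linear_dual (linearP l) lp.
exists (- phi), (- phi x0 - (fine (f x0) - 1)) => x.
have [fx|fx] := pselect (edom f x); last first.
  by move/negP: fx; rewrite -leNgt leye_eq => /eqP ->; rewrite leey.
rewrite (Gamma0_fineK Gf fx) lee_fin dualNE.
have := lx _ fx; rewrite /= -phiE linearB/=.
lra.
Qed.

Lemma affine_minorant_edom f u c : Gamma0 f ->
  (forall x, edom f x -> u x - c <= fine (f x)) -> affine_minorant f u c.
Proof.
move=> Gf H x; have [fx|fx] := pselect (edom f x).
  by rewrite (Gamma0_fineK Gf fx) lee_fin; exact: H.
by move/negP: fx; rewrite -leNgt leye_eq => /eqP ->; rewrite leey.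
Qed.

Lemma affine_minorant_fine f u c x : Gamma0 f -> affine_minorant f u c ->
  edom f x -> u x - c <= fine (f x).
Proof.
by move=> Gf H fx; have := H x; rewrite [leRHS](Gamma0_fineK Gf fx) lee_fin.
Qed.

Lemma affine_minorantD f g u v c d : affine_minorant f u c -> affine_minorant g v d ->
  affine_minorant (f \+ g)%E (u + v) (c + d).
Proof.
move=> fu gv x; apply: le_trans (leeD (fu x) (gv x)).
by rewrite -EFinD lee_fin dualDE; lra.
Qed.

Lemma subdifferentialP f x u : Gamma0 f -> subdifferential f x u <->
  edom f x /\ affine_minorant f u (u x - fine (f x)).
Proof.
move=> Gf; split.
  move=> [fx H]; have Dx : edom f x by rewrite /edom/= ltey_eq fx.
  split=> // y.
  have fxE := Gamma0_fineK Gf Dx.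
  have : ((u y)%:E - f y <= (u x - fine (f x))%:E)%E.
    apply: (@le_trans _ _ (conjugate f u)); first by apply: ereal_sup_ubound; exists y.
    by rewrite EFinB leeBrDr// -fxE.
  have [fN _ _ _] := Gf.
  by have := fN y; case: (f y) => [r| |] //= _; rewrite ?leey// -EFinB !lee_fin; lra.
move=> [Dx H]; have fxE := Gamma0_fineK Gf Dx.
split; first by rewrite fxE.
rewrite fxE -leeBrDr// -EFinB; apply: ge_ereal_sup => _ [y _ <-].
have [fN _ _ _] := Gf.
by have := H y; have := fN y; case: (f y) => [r| |] //= _; rewrite ?leNye// -EFinB !lee_fin; lra.
Qed.

End Gamma0_facts.

(** * The hull as a biconjugate *)

Section hull.
Context {R : realType}.

Lemma weak_star_nbhs0 {Y : normedModType R} (phi : Y) (e : R) : 0 < e ->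
  nbhs ((0 : dual Y) : weak_star Y) [set eta : weak_star Y | `|(eta : dual Y) phi| < e].
Proof.
move=> e0.
pose T := weak_star Y.
have c1 : continuous (fun eta : T => ((eta : dual Y) : {ptws Y -> R^o})).
  exact: initial_continuous.
have := c1 (0 : dual Y).
move=> /(@pointwise_cvgP _ _ (nbhs ((0 : dual Y) : T)))/(_ phi).
move=> /cvgrPdist_lt/(_ _ e0) H; apply: (@filterS _ (nbhs ((0 : dual Y) : T)) _ _ _ _ H) => eta /=.
by rewrite sub0r normrN.
Qed.

(** A basis of neighborhoods of the origin for the topology of pointwise
    convergence. *)
Lemma weak_star_nbhs0_ex {Y : normedModType R} (U : set (dual Y)) :
  nbhs ((0 : dual Y) : weak_star Y) U ->
  exists (s : seq Y) (e : R), 0 < e /\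
    forall eta : dual Y, (forall phi, phi \in s -> `|eta phi| < e) -> U eta.
Proof.
pose G : set_system (dual Y) := [set U | exists (s : seq Y) (e : R), 0 < e /\
    forall eta : dual Y, (forall phi, phi \in s -> `|eta phi| < e) -> U eta].
have FG : Filter G.
  split.
  - by exists [::], 1; split.
  - move=> A B [s [e [e0 sA]]] [t [d [d0 tB]]]; exists (s ++ t), (Num.min e d).
    split; first by rewrite lt_min e0.
    move=> eta H; split.
      by apply: sA => phi phis; have := H phi; rewrite mem_cat phis lt_min => /(_ isT)/andP[].
    by apply: tB => phi phis; have := H phi; rewrite mem_cat phis orbT lt_min => /(_ isT)/andP[].
  - by move=> A B AB [s [e [e0 sA]]]; exists s, e; split=> // eta /sA /AB.
have Gcvg : {ptws, (fun eta : dual Y => (eta : Y -> R^o)) @ G --> ((0 : dual Y) : Y -> R^o)}.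
  apply/pointwise_cvgP => phi; apply/cvgrPdist_lt => e e0.
  exists [:: phi], e; split=> // eta /(_ phi (mem_head _ _)) /=.
  by rewrite sub0r normrN.
rewrite nbhsE => -[O [[V Vo VO] O0] OU].
have : nbhs ((0 : dual Y) : {ptws Y -> R^o}) V.
  by apply: open_nbhs_nbhs; split=> //; rewrite -VO in O0.
move=> /Gcvg [s [e [e0 H]]]; exists s, e; split=> // eta /H Veta.
by apply: OU; rewrite -VO.
Qed.

Context {X : normedModType R}.
Implicit Types (f g : X -> \bar R) (xi : dual (dual X)).

(** The hull is at least the biconjugate. *)
Lemma affine_minorant_hull f u c xi : affine_minorant f u c ->
  ((xi u - c)%:E <= weak_star_hull f xi)%E.
Proof.
move=> fu; apply/lee_subgt0Pr => e e0.
apply: (@le_trans _ _ (ereal_inf (f @` [set y | `|(bidual_embedding y - xi) u| < e]))).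
  apply: le_ereal_inf_tmp => _ [y /= ye <-]; apply: le_trans (fu y).
  rewrite -EFinB lee_fin.
  have {}ye : `|u y - xi u| < e := ye.
  by move: ye; rewrite ltr_norml => /andP[]; lra.
apply: ereal_sup_ubound => /=.
by exists [set eta : dual (dual X) | `|eta u| < e] => //; exact: weak_star_nbhs0.
Qed.

(** The hull is at most the biconjugate: every real number below the hull at
    [xi] is attained by an affine minorant of [f]. The bound of [f] on a basic
    neighborhood of [xi] is a statement about finitely many forms, so the
    sandwich theorem is applied to the image of [f] in a space of row vectors. *)
Lemma hull_affine_minorant f xi r : Gamma0 f -> (r%:E < weak_star_hull f xi)%E ->
  exists u c, affine_minorant f u c /\ r <= xi u - c.
Proof.
move=> Gf /ereal_sup_gt[_ [U /weak_star_nbhs0_ex[s0 [e [e0 sU]]] <-] rU].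
have [u0 [c0 fu0]] := Gamma0_affine_minorant Gf.
(* Adding an affine minorant [u0 - c0] to the forms that define the
   neighborhood controls [f] outside of it as well, hence the choice of [K]. *)
pose s := u0 :: s0; pose k := size s.
pose phi (i : 'I_k) : dual X := s`_i.
have fr y : (forall i, `|phi i y - xi (phi i)| < e) -> (r%:E <= f y)%E.
  move=> H; apply/ltW/(lt_le_trans rU); apply: ereal_inf_lbound.
  exists y => //=; apply: sU => psi psis.
  have ks : (index psi s < k)%N by rewrite index_mem inE psis orbT.
  have := H (Ordinal ks); rewrite /phi /= nth_index ?inE ?psis ?orbT//.
pose S (v : 'rV[R]_k) := \sum_i `|v 0 i|.
pose K := 1 + `|r - xi u0 + c0| / e.
have K0 : 0 <= K by rewrite addr_ge0// divr_ge0// ltW.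
have sS : sublinear (fun v => K * S v).
  split=> [v w|t v t0].
    rewrite -mulrDr ler_wpM2l// /S -big_split /=.
    by apply: ler_sum => i _; rewrite mxE ler_normD.
  rewrite mulrCA; congr (_ * _); rewrite /S mulr_sumr.
  by apply: eq_bigr => i _; rewrite mxE normrM ger0_norm.
pose Phi (y : X) : 'rV[R]_k := \row_i (phi i y - xi (phi i)).
have lb y : edom f y -> r <= fine (f y) + K * S (Phi y).
  move=> fy; have S0 : 0 <= S (Phi y) by exact: sumr_ge0.
  have Si i : `|Phi y 0 i| <= S (Phi y).
    by rewrite /S (bigD1 i)//= lerDl sumr_ge0.
  have [H|/existsNP[i Hi]] := pselect (forall i, `|phi i y - xi (phi i)| < e).
    have := fr _ H; rewrite [leRHS](Gamma0_fineK Gf fy) lee_fin.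
    by have := mulr_ge0 K0 S0; lra.
  have eS : e <= S (Phi y).
    by apply: le_trans (Si i); rewrite mxE leNgt; apply/negP.
  have := affine_minorant_fine Gf fu0 fy.
  have : `|u0 y - xi u0| <= S (Phi y).
    by have := Si (Ordinal (isT : (0 < k)%N)); rewrite mxE.
  rewrite ler_norml => /andP[H1 _].
  have : `|r - xi u0 + c0| <= `|r - xi u0 + c0| / e * S (Phi y).
    by rewrite mulrAC ler_pdivlMr// ler_wpM2l.
  have := ler_norm (r - xi u0 + c0).
  by rewrite /K mulrDl mul1r; move: H1; lra.
pose A : set ('rV[R]_k * R) :=
  [set x | exists y, [/\ edom f y, x.1 = Phi y & x.2 <= r - fine (f y)]].
have [||v z [y [/= fy -> zy]]|l [lS lA]] := @mazur_orlicz _ _ _ A sS.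
- move=> v w z z' t t01 [y [/= fy -> zy]] [y' [/= fy' -> zy']].
  have [fz Hz] := Gamma0_convex_on Gf t01 fy fy'.
  exists (t *: y + (1 - t) *: y'); split=> //=.
    have aux (a b c : R) : t * (a - c) + (1 - t) * (b - c) = t * a + (1 - t) * b - c.
      by lra.
    by apply/rowP => i; rewrite !mxE linearD !linearZ; exact: aux.
  have /andP[t0 t1] := t01.
  apply: (@le_trans _ _ (t * (r - fine (f y)) + (1 - t) * (r - fine (f y')))).
    by rewrite lerD// ler_wpM2l// subr_ge0.
  by move: Hz => /=; lra.
- have [_ [y fy] _ _] := Gf.
  by exists (Phi y, r - fine (f y)), y.
- by have := lb _ fy; lra.
pose w : dual X := \sum_i (l (delta_mx 0 i) : R) *: phi i.
have lPhi y : l (Phi y) = w y - xi w.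
  rewrite [in LHS](row_sum_delta (Phi y)) linear_sum/= /w dual_sumE linear_sum /= -sumrB.
  have aux (a b c : R) : (a - b) * c = c * a - c * b by lra.
  apply: eq_bigr => i _; have -> := linearZ_LR xi (l (delta_mx 0 i)) (phi i).
  have -> := linearZ_LR l (Phi y 0 i) (delta_mx 0 i).
  by rewrite mxE; exact: aux.
exists (- w), (- xi w - r); split; last by rewrite linearN/=; lra.
apply: affine_minorant_edom => // y fy.
have := lA (Phi y) (r - fine (f y)); rewrite lPhi dualNE.
have Ay : A (Phi y, r - fine (f y)) by exists y.
by move=> /(_ Ay); lra.
Qed.

Lemma weak_star_hullNy f xi : Gamma0 f -> weak_star_hull f xi != -oo%E.
Proof.
move=> /Gamma0_affine_minorant[u [c /(affine_minorant_hull xi)]].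
by rewrite -ltNye; apply: lt_le_trans; rewrite ltNyr.
Qed.

End hull.

(** * Approximation of subgradients *)

Section sum_of_two.
Context {R : realType}.

(** If the hull of the sum is at most the sum of the hulls, a subgradient [xs] of
    [f + g] at [x] is within [e] of the sum of two [e]-subgradients. Otherwise
    the sandwich theorem on the dual gives an element [xi] of the bidual that
    separates, and [- xi] contradicts the inequality between the hulls. *)
Lemma hull_sum_approx {X : normedModType R} (f g : X -> \bar R) x xs e :
  Gamma0 f -> Gamma0 g -> edom f x -> edom g x ->
  (forall xi, (weak_star_hull (f \+ g)%E xi <= weak_star_hull f xi + weak_star_hull g xi)%E) ->
  affine_minorant (f \+ g)%E xs (xs x - (fine (f x) + fine (g x))) -> 0 < e ->
  exists u c v d, [/\ affine_minorant f u c, affine_minorant g v d,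
    `|u + v - xs| <= e &
    (fine (f x) - u x + c) + (fine (g x) - v x + d) <= e].
Proof.
move=> Gf Gg fx gx fgh xsm e0.
set m : R := xs x - _ in xsm.
(* The weight [`|x| + 1] makes a small value of [c + d + K * `|u + v - xs|]
   control both the distance and the sum of the two Fenchel gaps at [x]. *)
pose K := `|x| + 1.
have K0 : 0 < K by rewrite /K ltr_wpDl.
suff [u [c [v [d [fu gv H]]]]] : exists u c v d, [/\ affine_minorant f u c,
    affine_minorant g v d & c + d + K * `|u + v - xs| < m + e].
  exists u, c, v, d.
  have Hx := dual_ler_norm (u + v - xs) x.
  have fux := affine_minorant_fine Gf fu fx.
  have gvx := affine_minorant_fine Gg gv gx.
  have : `|u x + v x - xs x| <= `|u + v - xs| * `|x| by exact: Hx.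
  rewrite ler_norml => /andP[H1 H2].
  have mE : m = xs x - (fine (f x) + fine (g x)) by [].
  have n0 : 0 <= `|u + v - xs| by [].
  have KE : K * `|u + v - xs| = `|u + v - xs| * `|x| + `|u + v - xs| by rewrite /K; ring.
  by split=> //; lra.
apply: contrapT => H.
have {}H u c v d : affine_minorant f u c -> affine_minorant g v d ->
    m + e <= c + d + K * `|u + v - xs|.
  by move=> fu gv; rewrite leNgt; apply/negP => Hlt; apply: H; exists u, c, v, d.
have sK : sublinear (fun w : dual X => K * `|w|).
  split=> [w z|t w t0]; first by rewrite -mulrDr ler_pM2l// ler_normD.
  by rewrite normrZ ger0_norm// mulrCA.
pose A : set (dual X * R) := [set z | exists u c v d,
  [/\ affine_minorant f u c, affine_minorant g v d, z.1 = u + v - xs & z.2 <= m + e - c - d]].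
have mconv (h : X -> \bar R) u c v d t : 0 <= t <= 1 ->
    affine_minorant h u c -> affine_minorant h v d ->
    affine_minorant h (t *: u + (1 - t) *: v) (t * c + (1 - t) * d).
  move=> /andP[t0 t1] hu hv y; rewrite dualDE !dualZE.
  have := hu y; have := hv y; case: (h y) => [r| |]; rewrite ?leey ?leeNy_eq// !lee_fin.
  by move=> H1 H2; nra.
have [||w z [u [c [v [d [/= fu gv -> zm]]]]]|l [lK lA]] := @mazur_orlicz _ _ _ A sK.
- move=> w1 w2 z1 z2 t t01 [u1 [c1 [v1 [d1 [/= fu1 gv1 -> zm1]]]]].
  move=> [u2 [c2 [v2 [d2 [/= fu2 gv2 -> zm2]]]]].
  exists (t *: u1 + (1 - t) *: u2), (t * c1 + (1 - t) * c2).
  exists (t *: v1 + (1 - t) *: v2), (t * d1 + (1 - t) * d2).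
  split; [exact: mconv|exact: mconv| |] => /=.
    have aux (a1 b1 a2 b2 k : R) : t * (a1 + b1 - k) + (1 - t) * (a2 + b2 - k) =
      t * a1 + (1 - t) * a2 + (t * b1 + (1 - t) * b2) - k by ring.
    by apply/val_inj/funext => y; exact: aux.
  by have /andP[t0 t1] := t01; nra.
- have [u [c fu]] := Gamma0_affine_minorant Gf; have [v [d gv]] := Gamma0_affine_minorant Gg.
  by exists (u + v - xs, m + e - c - d), u, c, v, d.
- by have := H _ _ _ _ fu gv; lra.
have [xi xiE] := bounded_linear_dual (linearP l) lK.
have key u c v d : affine_minorant f u c -> affine_minorant g v d ->
    ((- xi) u - c) + ((- xi) v - d) <= (- xi) xs - m - e.
  move=> fu gv; have := lA (u + v - xs) (m + e - c - d).
  rewrite -xiE !dualNE linearB linearD /= => HA.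
  have /HA : A (u + v - xs, m + e - c - d) by exists u, c, v, d.
  by lra.
have /lt_le_trans/(_ (fgh (- xi))) :
    ((((- xi) xs : R) - m - e / 2)%:E < weak_star_hull (f \+ g)%E (- xi)%R)%E.
  apply: lt_le_trans (affine_minorant_hull (- xi) xsm).
  by rewrite lte_fin; lra.
move=> /(lte_split (weak_star_hullNy _ Gf) (weak_star_hullNy _ Gg))[a [b [af bg ab]]].
have [u [c [fu ua]]] := hull_affine_minorant Gf af.
have [v [d [gv vb]]] := hull_affine_minorant Gg bg.
by have := key _ _ _ _ fu gv; lra.
Qed.

Context {X : completeNormedModType R}.
Implicit Types (f g : X -> \bar R).

Lemma dual_seminorm_cvg (u : dual X) s l d : seminorm_cvg (fun x : X => `|x|) s l ->
  0 < d -> exists N, forall n, (N <= n)%N -> `|u (s n - l)| <= d.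
Proof.
move=> H d0; have u0 : 0 < `|u| + 1 by rewrite ltr_wpDl.
have [N HN] := H _ (divr_gt0 d0 u0); exists N => n /HN.
rewrite ler_pdivlMr// => H1; apply: le_trans (dual_ler_norm _ _) _.
by apply: le_trans H1; rewrite mulrC ler_wpM2l// lerDl.
Qed.

(** A Broendsted-Rockafellar theorem: [u] is approximated by subgradients [v] at
    which the conjugate, equal to [v x - f x], is at most [c + e]. *)
Lemma broendsted_rockafellar f u c e : Gamma0 f -> affine_minorant f u c -> 0 < e ->
  exists x v, [/\ subdifferential f x v, `|v - u| <= e & v x - fine (f x) <= c + e].
Proof.
move=> Gf fu e0.
pose F x := fine (f x) - u x.
pose S := F @` edom f.
have hS : has_inf S.
  have [_ [x fx] _ _] := Gf; split; first by exists (F x), x.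
  exists (- c) => _ [y fy <-]; have := affine_minorant_fine Gf fu fy.
  by rewrite /F; lra.
have e40 : 0 < e / 4 by rewrite divr_gt0.
have [_ [x0 fx0 <-] xS] := inf_adherent e40 hS.
(* The point [x] found below may be far from the origin, but [lam * `|x|] stays
   small, which bounds [(v - u) x]. *)
pose lam := e / 4 / (1 + `|x0|).
have n0 : 0 < 1 + `|x0| by rewrite ltr_pwDl.
have lam0 : 0 < lam by rewrite divr_gt0.
have lamE : lam * (1 + `|x0|) = e / 4 by rewrite /lam divfK// gt_eqF.
have lamx : 0 <= lam * `|x0| by rewrite mulr_ge0// ltW.
have sl : sublinear (fun x : X => lam * `|x|).
  split=> [w z|t w t0]; first by rewrite -mulrDr ler_pM2l// ler_normD.
  by rewrite normrZ ger0_norm// mulrCA.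
have cl : seminorm_complete (fun x : X => lam * `|x|).
  move=> s sc; have [d d0|l sl'] := @norm_complete _ X s.
    have [N HN] := sc _ (mulr_gt0 lam0 d0); exists N => n k Nn nk.
    by rewrite -(ler_pM2l lam0) HN.
  exists l => d d0; have [N HN] := sl' _ (divr_gt0 d0 lam0).
  by exists N => n /HN; rewrite ler_pdivlMr// mulrC.
have cvgE s l : seminorm_cvg (fun x : X => lam * `|x|) s l -> seminorm_cvg (fun x : X => `|x|) s l.
  move=> H d d0; have [N HN] := H _ (mulr_gt0 lam0 d0); exists N => n /HN.
  by rewrite ler_pM2l.
have Fc : closed_sublevels (fun x : X => lam * `|x|) (edom f) F.
  move=> s l r /cvgE sl' H.
  have H1 d : 0 < d -> (f l <= (r + u l + d)%:E)%E.
    move=> d0; rewrite leNgt; apply/negP => /(Gamma0_lsc_seq Gf sl')[N HN].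
    have [M HM] := dual_seminorm_cvg u sl' d0.
    have [Dn Fn] := H (N + M)%N; have := HN (N + M)%N (leq_addr _ _).
    rewrite (Gamma0_fineK Gf Dn) lte_fin.
    have := HM (N + M)%N (leq_addl _ _); rewrite linearB/= ler_norml => /andP[_].
    by move: Fn; rewrite /F; lra.
  have fl : edom f l by apply: le_lt_trans (H1 1 ltr01) _; rewrite ltry.
  split=> //; rewrite /F; apply/ler_addgt0Pr => d /H1.
  by rewrite (Gamma0_fineK Gf fl) lee_fin; lra.
have cF : convex_on (edom f) F.
  move=> y z t t01 fy fz; have [fw] := Gamma0_convex_on Gf t01 fy fz.
  split=> //; rewrite /F linearD !linearZ.
  have aux (a1 a2 p q k : R) : k <= t * p + (1 - t) * q ->
    k - (t * a1 + (1 - t) * a2) <= t * (p - a1) + (1 - t) * (q - a2) by lra.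
  exact: aux.
have lN (y : X) : lam * `|- y| = lam * `|y| by rewrite normrN.
have Fm z : edom f z -> - c <= F z.
  by move=> /(affine_minorant_fine Gf fu); rewrite /F; lra.
have [x [l [fx Fx lp lmin]]] := ekeland_subgradient sl lN cl Fc cF Fm fx0.
have [phi phiE] := bounded_linear_dual (linearP l) lp.
have sub : subdifferential f x (u - phi).
  apply/subdifferentialP => //; split=> //; apply: affine_minorant_edom => // y fy.
  have pB : phi (y - x) = phi y - phi x by exact: linearB.
  by have := lmin _ fy; rewrite -phiE pB /F !dualDE !dualNE; lra.
have phin : `|phi| <= lam.
  by apply: dual_norm_le_linear => [|y]; [exact: ltW|rewrite phiE].
exists x, (u - phi); split=> //.
  rewrite addrAC subrr sub0r normrN; apply: le_trans phin _.
  by move: lamE; rewrite mulrDr mulr1; lra.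
have Sx : F x0 < F x + e / 4.
  by apply: lt_le_trans xS _; rewrite lerD2r; apply: ge_inf; [exact: hS.2|exists x].
have xlam : lam * `|x| <= e / 2.
  have : lam * `|x| <= lam * (`|x - x0| + `|x0|).
    by rewrite ler_pM2l// -{1}(subrK x0 x) ler_normD.
  by rewrite [leRHS]mulrDr; move: lamE Fx; rewrite mulrDr mulr1; lra.
have := Fm _ fx; rewrite dualDE dualNE.
have : `|phi x| <= lam * `|x|.
  by apply: le_trans (dual_ler_norm _ _) _; rewrite ler_wpM2r.
by rewrite ler_norml /F => /andP[]; lra.
Qed.


End sum_of_two.

Section pair_seminorm.
Context {R : realType} {X : completeNormedModType R}.
Implicit Types (u : dual X) (z w : X * X) (e : R).

(** The seminorm on [X * X] that measures the perturbation in Ekeland's principle;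
    [u] is weighted on [z.1 - z.2] only. *)
Definition pair_seminorm e u z : R := e * (`|z.1| + `|z.2| + `|u (z.1 - z.2)|).

Lemma pair_seminorm_sublinear e u : 0 <= e -> sublinear (pair_seminorm e u).
Proof.
move=> e0; split=> [w z|t w t0]; rewrite /pair_seminorm /=.
  rewrite -mulrDr ler_wpM2l//.
  have -> : w.1 + z.1 - (w.2 + z.2) = (w.1 - w.2) + (z.1 - z.2).
    by rewrite opprD addrACA.
  have := ler_normD w.1 z.1; have := ler_normD w.2 z.2.
  have : `|u (w.1 - w.2 + (z.1 - z.2))| <= `|u (w.1 - w.2)| + `|u (z.1 - z.2)|.
    by rewrite linearD; exact: ler_normD.
  by lra.
rewrite !normrZ -scalerBr.
have -> : u (t *: (w.1 - w.2)) = t * u (w.1 - w.2) by exact: linearZ_LR.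
by rewrite normrM ger0_norm//; ring.
Qed.

Lemma pair_seminormN e u z : pair_seminorm e u (- z) = pair_seminorm e u z.
Proof. by rewrite /pair_seminorm /= !normrN -opprD linearN normrN. Qed.

Lemma pair_seminorm_ge1 e u z : 0 <= e -> e * `|z.1| <= pair_seminorm e u z.
Proof. by move=> e0; rewrite ler_wpM2l// -addrA lerDl addr_ge0. Qed.

Lemma pair_seminorm_ge2 e u z : 0 <= e -> e * `|z.2| <= pair_seminorm e u z.
Proof. by move=> e0; rewrite ler_wpM2l// addrAC lerDr addr_ge0. Qed.

Lemma pair_seminorm_cvg e u s l : 0 < e -> seminorm_cvg (pair_seminorm e u) s l ->
  seminorm_cvg (fun x : X => `|x|) (fun n => (s n).1) l.1 /\
  seminorm_cvg (fun x : X => `|x|) (fun n => (s n).2) l.2.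
Proof.
move=> e0 H; split=> k k0; have [M HM] := H _ (mulr_gt0 e0 k0); exists M => n /HM.
  by move=> /(le_trans (pair_seminorm_ge1 _ _ (ltW e0))); rewrite ler_pM2l.
by move=> /(le_trans (pair_seminorm_ge2 _ _ (ltW e0))); rewrite ler_pM2l.
Qed.

Lemma cvg_pair_seminorm e u s l : 0 < e ->
  seminorm_cvg (fun x : X => `|x|) (fun n => (s n).1) l.1 ->
  seminorm_cvg (fun x : X => `|x|) (fun n => (s n).2) l.2 ->
  seminorm_cvg (pair_seminorm e u) s l.
Proof.
move=> e0 H1 H2 k k0.
have k40 : 0 < k / e / 4 by rewrite !divr_gt0.
have [M1 HM1] := H1 _ k40; have [M2 HM2] := H2 _ k40.
have [M3 HM3] := dual_seminorm_cvg u H1 k40; have [M4 HM4] := dual_seminorm_cvg u H2 k40.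
exists (M1 + M2 + M3 + M4)%N => n Mn.
have /HM1 h1 : (M1 <= n)%N by lia.
have /HM2 h2 : (M2 <= n)%N by lia.
have /HM3 h3 : (M3 <= n)%N by lia.
have /HM4 h4 : (M4 <= n)%N by lia.
rewrite /pair_seminorm -ler_pdivlMl// mulrC /=.
have : `|u ((s n).1 - l.1 - ((s n).2 - l.2))| <=
    `|u ((s n).1 - l.1)| + `|u ((s n).2 - l.2)|.
  by rewrite linearB; exact: ler_normB.
by move: h1 h2 h3 h4; lra.
Qed.

Lemma pair_seminorm_complete e u : 0 < e -> seminorm_complete (pair_seminorm e u).
Proof.
move=> e0 s sc.
have [|l1 Hl1] := @norm_complete _ X (fun n => (s n).1).
  move=> k k0; have [M HM] := sc _ (mulr_gt0 e0 k0); exists M => n q Mn nq.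
  have /(le_trans (pair_seminorm_ge1 _ _ (ltW e0))) := HM _ _ Mn nq.
  by rewrite ler_pM2l.
have [|l2 Hl2] := @norm_complete _ X (fun n => (s n).2).
  move=> k k0; have [M HM] := sc _ (mulr_gt0 e0 k0); exists M => n q Mn nq.
  have /(le_trans (pair_seminorm_ge2 _ _ (ltW e0))) := HM _ _ Mn nq.
  by rewrite ler_pM2l.
by exists (l1, l2); exact: cvg_pair_seminorm.
Qed.

End pair_seminorm.

Section pair_tilt.
Context {R : realType} {X : completeNormedModType R}.
Implicit Types (f g : X -> \bar R) (u v : dual X).

(** The function [f a + g b] tilted by [u a + v b], on [edom f] times [edom g]. *)
Definition pair_tilt f g u v (z : X * X) : R :=
  (fine (f z.1) - u z.1) + (fine (g z.2) - v z.2).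

Definition pair_dom f g : set (X * X) := [set z | edom f z.1 /\ edom g z.2].

Lemma pair_tilt_closed_sublevels f g u v w e : Gamma0 f -> Gamma0 g -> 0 < e ->
  closed_sublevels (pair_seminorm e w) (pair_dom f g) (pair_tilt f g u v).
Proof.
move=> Gf Gg e0 s l r /(pair_seminorm_cvg e0)[sl1 sl2] H.
have [fN _ _ _] := Gf; have [gN _ _ _] := Gg.
have H1 k : 0 < k -> (f l.1 + g l.2 <= (r + u l.1 + v l.2 + k)%:E)%E.
  move=> k0; have k20 : 0 < k / 2 by rewrite divr_gt0.
  rewrite leNgt; apply/negP => /(lte_split (fN _) (gN _))[a [b [al bl kab]]].
  have [M1 HM1] := Gamma0_lsc_seq Gf sl1 al; have [M2 HM2] := Gamma0_lsc_seq Gg sl2 bl.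
  have [M3 HM3] := dual_seminorm_cvg u sl1 k20.
  have [M4 HM4] := dual_seminorm_cvg v sl2 k20.
  have [n Mn] : exists n, (M1 + M2 + M3 + M4 <= n)%N by exists (M1 + M2 + M3 + M4)%N.
  have /HM1 : (M1 <= n)%N by lia.
  have /HM2 : (M2 <= n)%N by lia.
  have /HM3 : (M3 <= n)%N by lia.
  have /HM4 : (M4 <= n)%N by lia.
  have [[D1 D2]] := H n.
  rewrite /pair_tilt (Gamma0_fineK Gf D1) (Gamma0_fineK Gg D2) !lte_fin /=.
  have -> : u ((s n).1 - l.1) = u (s n).1 - u l.1 by exact: linearB.
  have -> : v ((s n).2 - l.2) = v (s n).2 - v l.2 by exact: linearB.
  by rewrite !ler_norml => H0 /andP[_ h4] /andP[_ h3]; lra.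
have fl : edom f l.1 /\ edom g l.2.
  have := le_lt_trans (H1 1 ltr01) (ltry _).
  rewrite /edom/=; case: (f l.1) (fN l.1) => [?| |]//.
    by case: (g l.2) (gN l.2) => [?| |]//; rewrite ?ltry.
  by case: (g l.2) (gN l.2).
split=> //; rewrite /pair_tilt; apply/ler_addgt0Pr => k /H1.
by rewrite (Gamma0_fineK Gf fl.1) (Gamma0_fineK Gg fl.2) -EFinD lee_fin; lra.
Qed.

Lemma pair_tilt_convex_on f g u v : Gamma0 f -> Gamma0 g ->
  convex_on (pair_dom f g) (pair_tilt f g u v).
Proof.
move=> Gf Gg y z t t01 [fy gy] [fz gz].
have [fw fw'] := Gamma0_convex_on Gf t01 fy fz.
have [gw gw'] := Gamma0_convex_on Gg t01 gy gz.
split=> //; rewrite /pair_tilt /=.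
have lin (w : dual X) a1 a2 : w (t *: a1 + (1 - t) *: a2) = t * w a1 + (1 - t) * w a2.
  by rewrite linearD !linearZ.
rewrite !lin.
have aux (a1 a2 b1 b2 p1 p2 q1 q2 k1 k2 : R) : k1 <= t * p1 + (1 - t) * p2 ->
  k2 <= t * q1 + (1 - t) * q2 ->
  (k1 - (t * a1 + (1 - t) * a2)) + (k2 - (t * b1 + (1 - t) * b2)) <=
  t * ((p1 - a1) + (q1 - b1)) + (1 - t) * ((p2 - a2) + (q2 - b2)) by lra.
exact: aux.
Qed.

(** Two [e * e]-subgradients [u] and [v] at the same point [x] are replaced by exact
    subgradients [a'] and [b'] at nearby points. The bounds do not involve the
    norms of [u] and [v]: only the sum [a' + b'] is compared to [u + v]. *)
Lemma exact_subgradients f g u c v d x e : Gamma0 f -> Gamma0 g ->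
  edom f x -> edom g x -> affine_minorant f u c -> affine_minorant g v d ->
  0 < e <= 1 -> (fine (f x) - u x + c) + (fine (g x) - v x + d) <= e * e ->
  exists a b a' b', [/\ subdifferential f a a' /\ subdifferential g b b',
    `|a - x| <= e, `|b - x| <= e, `|a' + b' - (u + v)| <= 2 * e &
    `|a' (a - b)| <= 2 * e].
Proof.
move=> Gf Gg fx gx fu gv /andP[e0 e1] gap; have e0' := ltW e0.
pose F := pair_tilt f g u v.
have Fm z : pair_dom f g z -> - c - d <= F z.
  move=> [/(affine_minorant_fine Gf fu) H1 /(affine_minorant_fine Gg gv) H2].
  by rewrite /F /pair_tilt; lra.
have Dx : pair_dom f g (x, x) by [].
have [[a b] [l [[/= fa gb] Fab lp lmin]]] := ekeland_subgradient
  (pair_seminorm_sublinear u e0') (@pair_seminormN _ _ e u)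
  (@pair_seminorm_complete _ _ e u e0) (@pair_tilt_closed_sublevels f g u v u e Gf Gg e0)
  (@pair_tilt_convex_on f g u v Gf Gg) Fm Dx.
pose w1 (h : X) : X * X := (h, 0).
pose w2 (h : X) : X * X := (0, h).
have w1l : linear (l \o w1).
  move=> t h k /=; rewrite -[RHS]linearP; congr (l _).
  by rewrite /w1; congr pair; rewrite /= scaler0 addr0.
have w2l : linear (l \o w2).
  move=> t h k /=; rewrite -[RHS]linearP; congr (l _).
  by rewrite /w2; congr pair; rewrite /= scaler0 addr0.
have lw1 h : (l (w1 h) : R) <= e * (`|h| + `|u h|).
  by apply: le_trans (lp _) _; rewrite /pair_seminorm /= normr0 addr0 subr0.
have lw2 h : (l (w2 h) : R) <= e * (`|h| + `|u h|).
  by apply: le_trans (lp _) _; rewrite /pair_seminorm /= normr0 add0r sub0r linearN normrN.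
have bnd h : e * (`|h| + `|u h|) <= (e * (1 + `|u|)) * `|h|.
  by rewrite -mulrA ler_pM2l// mulrDl mul1r lerD2l; exact: dual_ler_norm.
have [phi phiE] : exists phi : dual X, forall h, phi h = l (w1 h).
  apply: (bounded_linear_dual w1l) => h.
  by apply: le_trans (lw1 h) (bnd h).
have [psi psiE] : exists psi : dual X, forall h, psi h = l (w2 h).
  apply: (bounded_linear_dual w2l) => h.
  by apply: le_trans (lw2 h) (bnd h).
have subf : subdifferential f a (u - phi).
  apply/subdifferentialP => //; split=> //; apply: affine_minorant_edom => // y fy.
  have pB : phi (y - a) = phi y - phi a by exact: linearB.
  have := lmin (y, b) (conj fy gb).
  have -> : (y, b) - (a, b) = w1 (y - a) by congr pair; rewrite /= ?subrr.
  by rewrite -phiE pB /F /pair_tilt !dualDE !dualNE /=; lra.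
have subg : subdifferential g b (v - psi).
  apply/subdifferentialP => //; split=> //; apply: affine_minorant_edom => // y gy.
  have pB : psi (y - b) = psi y - psi b by exact: linearB.
  have := lmin (a, y) (conj fa gy).
  have -> : (a, y) - (a, b) = w2 (y - b) by congr pair; rewrite /= ?subrr.
  by rewrite -psiE pB /F /pair_tilt !dualDE !dualNE /=; lra.
have Nab : `|a - x| + `|b - x| + `|u (a - b)| <= e.
  have abE : a - b = (a - x) - (b - x) by rewrite opprB addrA subrK.
  rewrite -(ler_pM2l e0) abE; have := Fm (a, b) (conj fa gb).
  by move: Fab gap; rewrite /F /pair_tilt /pair_seminorm /=; lra.
have ax0 := normr_ge0 (a - x); have bx0 := normr_ge0 (b - x).
have uab0 : 0 <= `|u (a - b)| by [].
exists a, b, (u - phi), (v - psi); split=> //.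
- by lra.
- by lra.
- have -> : u - phi + (v - psi) - (u + v) = - (phi + psi).
    by rewrite addrACA [LHS]addrC addKr opprD.
  rewrite normrN; apply: dual_norm_le_linear => [|h]; first by rewrite mulr_ge0.
  rewrite dualDE phiE psiE.
  have -> : (l (w1 h) : R) + l (w2 h) = l (h, h).
    by rewrite -linearD; congr (l (_, _)); rewrite /= ?addr0 ?add0r.
  (* On the diagonal the [u]-part of the seminorm vanishes. *)
  by apply: le_trans (lp _) _; rewrite /pair_seminorm /= subrr linear0 normr0 addr0; lra.
- have uab : `|a - b| + `|u (a - b)| <= e.
    have : `|a - b| <= `|a - x| + `|b - x|.
      have -> : a - b = (a - x) - (b - x) by rewrite opprB addrA subrK.
      exact: ler_normB.
    by lra.
  have phiab : `|phi (a - b)| <= e.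
    apply: (@le_trans _ _ (e * (`|a - b| + `|u (a - b)|))).
      suff : `|(phi (a - b) : R)| <= e * (`|a - b| + `|u (a - b)|) by [].
      rewrite ler_norml; apply/andP; split; last by rewrite phiE lw1.
      have := lw1 (- (a - b)); rewrite -phiE normrN.
      have -> : phi (- (a - b)) = - phi (a - b) by exact: linearN.
      have -> : u (- (a - b)) = - u (a - b) by exact: linearN.
      by rewrite normrN; lra.
    by apply: le_trans (_ : e * e <= _); rewrite ?ler_pM2l// ler_piMl.
  rewrite dualDE dualNE; apply: le_trans (ler_normB _ _) _.
  have := normr_ge0 (a - b).
  by move: phiab uab; lra.
Qed.

End pair_tilt.

(** * The sum rule and the hull of the sum *)

Section equivalence.
Context {R : realType} {X : completeNormedModType R}.
Implicit Types (f g : X -> \bar R).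

Lemma subdifferential_fine_le f x y u : Gamma0 f -> subdifferential f x u -> edom f y ->
  fine (f x) - fine (f y) <= u (x - y).
Proof.
move=> Gf /(subdifferentialP _ _ Gf)[fx H] fy.
have := affine_minorant_fine Gf H fy.
have -> : u (x - y) = u x - u y by exact: linearB.
by lra.
Qed.

Lemma squeeze_le (s : nat -> R) l (b : nat -> R) : (forall n, `|s n - l| <= b n) ->
  b @ \oo --> (0 : R) -> s @ \oo --> l.
Proof.
move=> sb b0; apply/cvgrPdist_le => e e0.
have /cvgrPdist_le/(_ _ e0) := b0; apply: filterS => n /=.
rewrite sub0r normrN distrC => /(le_trans (ler_norm _)); exact: le_trans.
Qed.

Lemma Gamma0_lsc_near f (s : nat -> X) x : Gamma0 f -> edom f x -> s @ \oo --> x ->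
  forall e, 0 < e -> \forall n \near \oo, ((fine (f x) - e)%:E < f (s n))%E.
Proof.
move=> Gf fx sx e e0; have [_ _ lf _] := Gf.
have [|V Vx Vf] := lf x (fine (f x) - e).
  by rewrite [ltRHS](Gamma0_fineK Gf fx) lte_fin; lra.
have Vn : \forall n \near \oo, V (s n) := sx _ Vx.
by apply: filterS Vn => n; exact: Vf.
Qed.

Lemma edom_add f g x : Gamma0 f -> Gamma0 g -> edom (f \+ g)%E x -> edom f x /\ edom g x.
Proof.
move=> [fN _ _ _] [gN _ _ _]; rewrite /edom/=.
by case: (f x) (fN x) => [?| |]//; case: (g x) (gN x) => [?| |]//; rewrite ?ltry.
Qed.

(** The sequential sum rule. Exact subgradients with the required limits are given
    by [exact_subgradients]; it controls only the sum of the two pairings, and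
    lower semicontinuity bounds each of them from below. *)
Lemma sum_rule_of_hull f g x xs : Gamma0 f -> Gamma0 g ->
  (forall xi, (weak_star_hull (f \+ g)%E xi <= weak_star_hull f xi + weak_star_hull g xi)%E) ->
  edom f `&` edom g !=set0 ->
  subdifferential (f \+ g)%E x xs ->
    exists (xn yn : nat -> X) (xsn ysn : nat -> dual X),
      [/\ xn @ \oo --> x, yn @ \oo --> x,
          forall n, subdifferential f (xn n) (xsn n) &
          forall n, subdifferential g (yn n) (ysn n)] /\
      [/\ xsn n (xn n - x) @[n --> \oo] --> (0 : R),
          ysn n (yn n - x) @[n --> \oo] --> (0 : R),
          f (xn n) @[n --> \oo] --> f x,
          g (yn n) @[n --> \oo] --> g x &
          `|xsn n + ysn n - xs| @[n --> \oo] --> (0 : R)].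
Proof.
move=> Gf Gg fgh fg0; have Gfg := Gamma0_add Gf Gg fg0.
move=> /(subdifferentialP _ _ Gfg)[fgx xsm].
have [fN _ _ _] := Gf; have [gN _ _ _] := Gg.
have [fx gx] := edom_add Gf Gg fgx.
have fgE : fine ((f \+ g)%E x) = fine (f x) + fine (g x).
  by rewrite /= (Gamma0_fineK Gf fx) (Gamma0_fineK Gg gx).
rewrite fgE in xsm.
have step n : exists z : (X * X) * (dual X * dual X), let e := harmonic n in
    [/\ subdifferential f z.1.1 z.2.1 /\ subdifferential g z.1.2 z.2.2,
    `|z.1.1 - x| <= e, `|z.1.2 - x| <= e, `|z.2.1 + z.2.2 - xs| <= 3 * e &
    `|z.2.1 (z.1.1 - z.1.2)| <= 2 * e].
  pose e : R := harmonic n; have e0 : 0 < e by exact: harmonic_gt0.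
  have e1 : e <= 1 by rewrite /e /harmonic /= invf_le1// ler1n.
  have ee0 : 0 < e * e by rewrite mulr_gt0.
  have [u [c [v [d [fu gv uv gap]]]]] := hull_sum_approx Gf Gg fx gx fgh xsm ee0.
  have e01 : 0 < e <= 1 by rewrite e0.
  have [a [b [a' [b' [ab ax bx sab aab]]]]] := exact_subgradients Gf Gg fx gx fu gv e01 gap.
  exists ((a, b), (a', b')); split=> //=.
  have -> : a' + b' - xs = (a' + b' - (u + v)) + (u + v - xs) by rewrite addrA subrK.
  apply: le_trans (ler_normD _ _) _.
  apply: le_trans (lerD sab uv) _; suff : 2 * e + e * e <= 3 * e by [].
  have : e * e <= e by rewrite ler_piMl// ltW.
  by lra.
have [z zP] := choice step.
pose xn n := (z n).1.1; pose yn n := (z n).1.2.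
pose xsn n := (z n).2.1; pose ysn n := (z n).2.2.
have h0 : (harmonic : nat -> R) @ \oo --> (0 : R) by exact: cvg_harmonic.
have hk (k : R) : (fun n => k * harmonic n : R) @ \oo --> (0 : R).
  by rewrite -[X in _ --> X](mulr0 k); apply: cvgMr.
have subf n : subdifferential f (xn n) (xsn n) by have [[]] := zP n.
have subg n : subdifferential g (yn n) (ysn n) by have [[]] := zP n.
have xncvg : xn @ \oo --> x.
  apply/cvgrPdist_le => e e0; have /cvgrPdist_le/(_ _ e0) := h0.
  apply: filterS => n /=; have [_ + _ _ _] := zP n; rewrite sub0r normrN distrC.
  by move=> H H1; apply: le_trans H _; apply: le_trans H1; exact: ler_norm.
have yncvg : yn @ \oo --> x.
  apply/cvgrPdist_le => e e0; have /cvgrPdist_le/(_ _ e0) := h0.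
  apply: filterS => n /=; have [_ _ + _ _] := zP n; rewrite sub0r normrN distrC.
  by move=> H H1; apply: le_trans H _; apply: le_trans H1; exact: ler_norm.
have sumcvg : `|xsn n + ysn n - xs| @[n --> \oo] --> (0 : R).
  apply: (squeeze_le _ (hk 3)) => n; rewrite subr0 normr_id.
  by have [_ _ _ + _] := zP n.
(* The two sequences of pairings have a sum tending to 0, because the large parts
   of [xsn n] and [ysn n] are opposite and [xsn n (xn n - yn n)] is small. *)
pose al n : R := xsn n (xn n - x); pose be n : R := ysn n (yn n - x).
have abcvg : (fun n => al n + be n) @ \oo --> (0 : R).
  apply: (squeeze_le _ (hk (`|xs| + 5))) => n; rewrite subr0.
  have [_ _ ynx sxs xsxy] := zP n.
  have e0 : 0 < harmonic n :> R by exact: harmonic_gt0.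
  have e1 : harmonic n <= 1 :> R by rewrite /harmonic /= invf_le1// ler1n.
  move: (harmonic n : R) ynx sxs xsxy e0 e1 => e ynx sxs xsxy e0 e1.
  have E : al n + be n = (xsn n + ysn n - xs) (yn n - x) + xs (yn n - x) + xsn n (xn n - yn n).
    have q1 : (xsn n + ysn n - xs) (yn n - x) =
      xsn n (yn n - x) + ysn n (yn n - x) - xs (yn n - x) by [].
    have q2 : xsn n (xn n - x) = xsn n (xn n - yn n) + xsn n (yn n - x).
      by rewrite -[RHS]linearD; congr (xsn n _); rewrite addrA subrK.
    by rewrite /al /be q1 q2; lra.
  rewrite E.
  have H1 := dual_ler_norm (xsn n + ysn n - xs) (yn n - x).
  have H2 := dual_ler_norm xs (yn n - x).
  have H3 : `|xsn n + ysn n - xs| * `|yn n - x| <= 3 * e * 1.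
    by rewrite ler_pM// (le_trans ynx).
  have H4 : `|xs| * `|yn n - x| <= `|xs| * e by rewrite ler_wpM2l.
  apply: le_trans (ler_normD _ _) _; apply: le_trans (lerD (ler_normD _ _) (lexx _)) _.
  have : `|xsn n (xn n - yn n)| <= 2 * e by [].
  by move: H1 H2; lra.
have dom (h : X -> \bar R) s t : Gamma0 h -> subdifferential h s t -> edom h s.
  by move=> Gh /(subdifferentialP _ _ Gh)[].
have alge n : fine (f (xn n)) - fine (f x) <= al n by exact: subdifferential_fine_le.
have bege n : fine (g (yn n)) - fine (g x) <= be n by exact: subdifferential_fine_le.
have evf := Gamma0_lsc_near Gf fx xncvg; have evg := Gamma0_lsc_near Gg gx yncvg.
have big e : 0 < e -> \forall n \near \oo, [/\ `|al n| <= e, `|be n| <= e,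
    `|fine (f (xn n)) - fine (f x)| <= e & `|fine (g (yn n)) - fine (g x)| <= e].
  move=> e0; have e20 : 0 < e / 2 by rewrite divr_gt0.
  have /cvgrPdist_le/(_ _ e20) Hab := abcvg.
  have Hf := evf _ e20; have Hg := evg _ e20.
  near=> n.
  have : `|0 - (al n + be n)| <= e / 2 by near: n.
  rewrite sub0r normrN ler_norml => /andP[H1 H2].
  have : ((fine (f x) - e / 2)%:E < f (xn n))%E by near: n.
  rewrite (Gamma0_fineK Gf (dom _ _ _ Gf (subf n))) lte_fin => H3.
  have : ((fine (g x) - e / 2)%:E < g (yn n))%E by near: n.
  rewrite (Gamma0_fineK Gg (dom _ _ _ Gg (subg n))) lte_fin => H4.
  have H5 := alge n; have H6 := bege n.
  by split; rewrite ler_norml; apply/andP; split; lra.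
exists xn, yn, xsn, ysn; split; split=> //.
- apply/cvgrPdist_le => e /big; apply: filterS => n [H _ _ _].
  by rewrite sub0r normrN.
- apply/cvgrPdist_le => e /big; apply: filterS => n [_ H _ _].
  by rewrite sub0r normrN.
- have -> : (fun n => f (xn n)) = (fun n => (fine (f (xn n)))%:E).
    by apply/funext => n; exact: (Gamma0_fineK Gf (dom _ _ _ Gf (subf n))).
  rewrite (Gamma0_fineK Gf fx); apply: cvg_EFin; first by near=> n.
  by apply/cvgrPdist_le => e /big; apply: filterS => n [_ _ H _]; rewrite distrC.
- have -> : (fun n => g (yn n)) = (fun n => (fine (g (yn n)))%:E).
    by apply/funext => n; exact: (Gamma0_fineK Gg (dom _ _ _ Gg (subg n))).
  rewrite (Gamma0_fineK Gg gx); apply: cvg_EFin; first by near=> n.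
  by apply/cvgrPdist_le => e /big; apply: filterS => n [_ _ _ H]; rewrite distrC.
Unshelve. all: by end_near.
Qed.

Lemma hull_add_le f g xi : Gamma0 f -> Gamma0 g ->
  (weak_star_hull f xi + weak_star_hull g xi <= weak_star_hull (f \+ g)%E xi)%E.
Proof.
move=> Gf Gg; apply: lee_real_lt => r.
move=> /(lte_split (weak_star_hullNy _ Gf) (weak_star_hullNy _ Gg))[a [b [af bg rab]]].
have [u [c [fu ua]]] := hull_affine_minorant Gf af.
have [v [d [gv vb]]] := hull_affine_minorant Gg bg.
apply: le_trans (affine_minorant_hull xi (affine_minorantD fu gv)).
have xiD : xi (u + v) = xi u + xi v by exact: linearD.
by rewrite lee_fin xiD; lra.
Qed.

(** It suffices to compare biconjugates: a minorant [w] of [f + g] is replaced by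
    a subgradient of [f + g], and then by a sum of minorants of [f] and [g]. *)
Lemma hull_of_sum_rule f g xi : Gamma0 f -> Gamma0 g -> edom f `&` edom g !=set0 ->
  (forall x xs, subdifferential (f \+ g)%E x xs -> forall e, 0 < e ->
     exists u c v d, [/\ affine_minorant f u c, affine_minorant g v d,
     `|u + v - xs| <= e & c + d <= xs x - fine ((f \+ g)%E x) + e]) ->
  (weak_star_hull (f \+ g)%E xi <= weak_star_hull f xi + weak_star_hull g xi)%E.
Proof.
move=> Gf Gg fg0 rule; have Gfg := Gamma0_add Gf Gg fg0.
apply: lee_real_lt => r /(hull_affine_minorant Gfg)[w [c [hw rw]]].
apply/lee_addgt0Pr => e e0.
have k0 : 0 < 2 + 2 * `|xi| by rewrite ltr_pwDl// mulr_ge0.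
pose k := e / (2 + 2 * `|xi|); have kp : 0 < k by rewrite divr_gt0.
have kE : k * (2 + 2 * `|xi|) = e by rewrite /k divfK// gt_eqF.
have [y [ys [ysub ysw yc]]] := broendsted_rockafellar Gfg hw kp.
have [u [p [v [q [fu gv uv pq]]]]] := rule _ _ ysub _ kp.
have := leeD (affine_minorant_hull xi fu) (affine_minorant_hull xi gv).
rewrite -EFinD => /(leeD2r e%:E); apply: le_trans.
rewrite -EFinD lee_fin; apply: (le_trans rw).
have H : `|xi (w - (u + v))| <= `|xi| * (2 * k).
  apply: le_trans (dual_ler_norm _ _) _; rewrite ler_wpM2l//.
  have -> : w - (u + v) = - (ys - w) - (u + v - ys) by rewrite !opprB addrA subrK.
  by apply: le_trans (ler_normB _ _) _; rewrite normrN; lra.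
have xiB : xi (w - (u + v)) = xi w - (xi u + xi v).
  by rewrite -[xi u + xi v]linearD; exact: linearB.
move: H; rewrite xiB ler_norml => /andP[_].
by move: kE pq yc; rewrite mulrDr; lra.
Qed.

End equivalence.

Theorem theorem5 (R : realType) (X : completeNormedModType R)
    (f g : X -> \bar R) (hf : Gamma0 f) (hg : Gamma0 g)
    (hfg : edom f `&` edom g !=set0) :
  weak_star_hull (f \+ g)%E = (weak_star_hull f \+ weak_star_hull g)%E
  <->
  forall (x : X) (xs : dual X), subdifferential (f \+ g)%E x xs ->
    exists (xn yn : nat -> X) (xsn ysn : nat -> dual X),
      [/\ xn @ \oo --> x, yn @ \oo --> x,
          forall n, subdifferential f (xn n) (xsn n) &
          forall n, subdifferential g (yn n) (ysn n)] /\
      [/\ xsn n (xn n - x) @[n --> \oo] --> (0 : R),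
          ysn n (yn n - x) @[n --> \oo] --> (0 : R),
          f (xn n) @[n --> \oo] --> f x,
          g (yn n) @[n --> \oo] --> g x &
          `|xsn n + ysn n - xs| @[n --> \oo] --> (0 : R)].
Proof.
split=> [hull x xs|rule].
  by apply: sum_rule_of_hull => // xi; rewrite hull.
apply/funext => xi; apply/eqP; rewrite eq_le hull_add_le// andbT.
apply: hull_of_sum_rule => // x xs sub e e0.
have [xn [yn [xsn [ysn [[xnx yny subf subg] [alx bey _ _ sn]]]]]] := rule _ _ sub.
have hG := Gamma0_add hf hg hfg.
have [fgx _] := (subdifferentialP _ _ hG).1 sub.
have [fx gx] := edom_add hf hg fgx.
(* Four error terms of size [d], and [d * `|x|] for the value at [x] of
   [xsn n + ysn n - xs]. *)
pose d := e / (4 + `|x|).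
have c0 : 0 < 4 + `|x| by rewrite ltr_pwDl.
have d0 : 0 < d by rewrite divr_gt0.
have dE : d * (4 + `|x|) = e by rewrite /d divfK// gt_eqF.
have de : d <= e by rewrite /d ler_pdivrMr// ler_peMr ?(ltW e0)//; have := normr_ge0 x; lra.
have [n [H1 H2 H3 H4 H5]] : exists n, [/\ `|0 - (xsn n (xn n - x) : R)| <= d,
   `|0 - (ysn n (yn n - x) : R)| <= d, ((fine (f x) - d)%:E < f (xn n))%E,
   ((fine (g x) - d)%:E < g (yn n))%E &
   `|0 - `|xsn n + ysn n - xs| | <= d].
  suff [N _ HN] : \forall n \near \oo, [/\ `|0 - (xsn n (xn n - x) : R)| <= d,
   `|0 - (ysn n (yn n - x) : R)| <= d, ((fine (f x) - d)%:E < f (xn n))%E,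
   ((fine (g x) - d)%:E < g (yn n))%E &
   `|0 - `|xsn n + ysn n - xs| | <= d].
    by exists N; apply: HN => /=.
  have /cvgrPdist_le/(_ _ d0) K1 := alx.
  have /cvgrPdist_le/(_ _ d0) K2 := bey.
  have K3 := Gamma0_lsc_near hf fx xnx d0.
  have K4 := Gamma0_lsc_near hg gx yny d0.
  have /cvgrPdist_le/(_ _ d0) K5 := sn.
  near=> n; split; near: n => //.
have [fxn fu] := (subdifferentialP _ _ hf).1 (subf n).
have [gyn gv] := (subdifferentialP _ _ hg).1 (subg n).
exists (xsn n), (xsn n (xn n) - fine (f (xn n))), (ysn n), (ysn n (yn n) - fine (g (yn n))).
rewrite sub0r normrN normr_id in H5.
split=> //; first exact: le_trans H5 de.
have Dx := dual_ler_norm (xsn n + ysn n - xs) x.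
have {}Dx : xsn n x + ysn n x - xs x <= d * `|x|.
  apply: le_trans (ler_norm _) _; apply: le_trans Dx _.
  by rewrite ler_wpM2r.
have E1 : xsn n (xn n - x) = xsn n (xn n) - xsn n x by exact: linearB.
have E2 : ysn n (yn n - x) = ysn n (yn n) - ysn n x by exact: linearB.
rewrite (Gamma0_fineK hf fxn) lte_fin in H3; rewrite (Gamma0_fineK hg gyn) lte_fin in H4.
rewrite /= (Gamma0_fineK hf fx) (Gamma0_fineK hg gx) -EFinD /=.
move: H1 H2 dE; rewrite E1 E2 !sub0r !normrN !ler_norml mulrDr => /andP[_ H1] /andP[_ H2].
by lra.
Unshelve. all: by end_near.
Qed.
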